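(* Let $m \ge 18$ and $n \ge m^2 - m + 1$ be integers, and let $UC_n$ be any connected graph on $n$ vertices containing exactly one cycle (equivalently, a connected graph with $n$ vertices and $n$ edges). Then $R(UC_n, F_m) = 2n - 1$.
   Context: All graphs are finite and simple. For graphs $H$ and $K$, the Ramsey number $R(H,K)$ is the smallest positive integer $N$ such that for every graph $G$ on $N$ vertices, either $G$ contains $H$ as a subgraph or the complement $\overline{G}$ contains $K$ as a subgraph. The fan $F_m$ is the graph on $2m+1$ vertices consisting of $m$ triangles sharing one common vertex (equivalently, a vertex joined to every vertex of a matching with $m$ edges). *)

(* Defs.v *)
From mathcomp Require Import all_boot.
Set Implicit Arguments. Unset Strict Implicit. Unset Printing Implicit Defensive.

Record sgraph (T : finType) : Type := SGraph {
  adj : rel T;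
  adj_sym : symmetric adj;
  adj_irrefl : irreflexive adj }.

Definition compl_adj (T : finType) (G : sgraph T) : rel T :=
  fun x y => (x != y) && ~~ adj G x y.

Lemma compl_sym (T : finType) (G : sgraph T) : symmetric (compl_adj G).
Proof. by move=> x y; rewrite /compl_adj eq_sym adj_sym. Qed.

Lemma compl_irrefl (T : finType) (G : sgraph T) : irreflexive (compl_adj G).
Proof. by move=> x; rewrite /compl_adj eqxx. Qed.

Definition compl (T : finType) (G : sgraph T) : sgraph T :=
  SGraph (@compl_sym T G) (@compl_irrefl T G).

Definition subgraph_of (U T : finType) (H : sgraph U) (G : sgraph T) : Prop :=
  exists f : U -> T, injective f /\ forall x y, adj H x y -> adj G (f x) (f y).

Definition ramsey_prop (U V : finType) (H : sgraph U) (K : sgraph V) (N : nat) : Prop :=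
  forall G : sgraph 'I_N, subgraph_of H G \/ subgraph_of K (compl G).

Definition is_ramsey_number (U V : finType) (H : sgraph U) (K : sgraph V) (N : nat) : Prop :=
  0 < N /\ ramsey_prop H K N /\ forall M, 0 < M < N -> ~ ramsey_prop H K M.

Definition num_edges (T : finType) (G : sgraph T) : nat :=
  #|[set p : T * T | adj G p.1 p.2]| %/ 2.

Definition connected_graph (T : finType) (G : sgraph T) : Prop :=
  forall x y : T, connect (adj G) x y.

(* unicyclic: connected, exactly one cycle; equivalently #E = #V and connected *)
Definition unicyclic (T : finType) (G : sgraph T) : Prop :=
  connected_graph G /\ num_edges G = #|T|.

(* The fan F_m: center None, matching edges Some(i,false)--Some(i,true). *)
Definition fan_adj (m : nat) : rel (option ('I_m * bool)) :=
  fun x y => match x, y with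
  | None, None => false
  | None, Some _ | Some _, None => true
  | Some (i, b), Some (j, c) => (i == j) && (b != c)
  end.

Lemma fan_sym m : symmetric (@fan_adj m).
Proof.
by case=> [[i b]|] [[j c]|] //=; rewrite (eq_sym i) (eq_sym b).
Qed.

Lemma fan_irrefl m : irreflexive (@fan_adj m).
Proof. by case=> [[i b]|] //=; rewrite !eqxx. Qed.

Definition fan (m : nat) : sgraph (option ('I_m * bool)) :=
  SGraph (@fan_sym m) (@fan_irrefl m).

(* Main.v *)
Require Import Defs.
From mathcomp Require Import all_boot.
From mathcomp Require Import zify.
Set Implicit Arguments. Unset Strict Implicit. Unset Printing Implicit Defensive.

(** Write k = m - 1, so that n >= k^2 + k + 1.  The lower bound comes from two
    disjoint cliques with at most n - 1 vertices each.  For the upper bound let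
    G have 2n - 1 vertices and suppose that its complement has no fan, that is,
    for every v the complement has no matching of size k + 1 inside the set
    N'(v) of the non-neighbours of v.  Then N'(v) contains a clique of G with at
    least |N'(v)| - 2k vertices.  Let d be the largest size of a set N'(v).

    - If d <= n - 2, then G has minimum degree at least n > (2n - 1)/2 and is
      pancyclic; embed the cycle of the target H, then the rest greedily.
    - If d >= n + k, then N'(v) contains a set of n vertices which is a clique up
      to at most k vertices with one non-neighbour each, and H fits into it.
    - Otherwise let U be a clique of size d - 2k in N'(v).  If H cannot be
      embedded by means of vertices of U of degree at least n - 1, then some a in
      U has degree at most n - 2 and N'(a) contains a second clique U2, of size
      n - 2k, disjoint from U.  Every vertex is adjacent to almost all of U or
      to many vertices of U2, so that one of the two sides has n vertices, and H
      is embedded there, the few vertices outside the clique being placed on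
      vertices of degree at most 2 of H ("slots").  When H has more than 2k
      leaves and k of them hang at one vertex p, then p is placed instead on a
      vertex of G of degree at least n - 1, which exists because the complement
      cannot have minimum degree at least n. *)

(** * Neighbourhoods, cliques and matchings of the complement *)

Section Neighbourhoods.
Variables (V : finType) (G : sgraph V).

Definition nb (x : V) : {set V} := [set y | adj G x y].
Definition conb (x : V) : {set V} := [set y | compl_adj G x y].
Definition clique (U : {set V}) := {in U &, forall x y, x != y -> adj G x y}.

Lemma in_nb x y : (y \in nb x) = adj G x y. Proof. by rewrite inE. Qed.
Lemma in_conb x y : (y \in conb x) = (x != y) && ~~ adj G x y.
Proof. by rewrite inE. Qed.
Lemma conb_sym x y : (y \in conb x) = (x \in conb y).
Proof. by rewrite !inE compl_sym. Qed.
Lemma nb_sym x y : (y \in nb x) = (x \in nb y).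
Proof. by rewrite !inE adj_sym. Qed.
Lemma nb_irr x : x \in nb x = false. Proof. by rewrite inE adj_irrefl. Qed.
Lemma conb_irr x : x \in conb x = false. Proof. by rewrite inE compl_irrefl. Qed.
Lemma adj_neq x y : adj G x y -> x != y.
Proof. by apply: contraTneq => ->; rewrite adj_irrefl. Qed.

Lemma card_nb_conb (A : {set V}) x :
  #|nb x :&: A| + #|conb x :&: A| + (x \in A) = #|A|.
Proof.
rewrite (setIC (nb x)) -[RHS](cardsID (nb x) A) -addnA; congr (_ + _).
rewrite -[RHS](cardsID (conb x)); congr (_ + _).
  apply: eq_card => y; rewrite !inE /compl_adj.
  by case: (adj G x y); case: (x == y); case: (y \in A).
have -> : A :\: nb x :\: conb x = A :&: [set x].
  apply/setP=> y; rewrite !inE /compl_adj eq_sym.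
  case: (altP (y =P x)) => [->|] /=; first by rewrite adj_irrefl andbT.
  by rewrite andbF; case: (adj G x y).
case xA: (x \in A); first by rewrite (setIidPr _) ?cards1 // sub1set.
by apply/esym/eqP; rewrite cards_eq0 setI_eq0 disjoint_sym disjoints1 xA.
Qed.

Lemma card_nb_conbT x : #|nb x| + #|conb x| + 1 = #|V|.
Proof. by have := card_nb_conb setT x; rewrite !setIT cardsT inE. Qed.

Lemma cliqueS (A B : {set V}) : A \subset B -> clique B -> clique A.
Proof. by move=> /subsetP AB cB x y xA yA; apply: cB; apply: AB. Qed.

(** A matching of the complement inside [A], as a list of oriented edges; [uniq] over all ends
    together makes the edges disjoint. *)
Definition comatching (A : {set V}) (s : seq (V * V)) :=
  uniq (unzip1 s ++ unzip2 s) &&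
  all (fun p => [&& p.1 \in A, p.2 \in A & compl_adj G p.1 p.2]) s.

Definition fanfree k := forall x s, comatching (conb x) s -> size s <= k.

Lemma comatching_perm A s s' : perm_eq s s' -> comatching A s = comatching A s'.
Proof.
move=> ss'; rewrite /comatching (perm_all _ ss'); congr (_ && _).
by apply: perm_uniq; apply: perm_cat; apply: perm_map.
Qed.

Lemma comatchingS (A B : {set V}) s :
  A \subset B -> comatching A s -> comatching B s.
Proof.
move=> /subsetP AB /andP[us As]; rewrite /comatching us /=.
by apply: sub_all As => p /and3P[? ? ->]; rewrite !AB.
Qed.

Lemma mem_ends_cons (a b : V) s z :
  (z \in unzip1 ((a, b) :: s) ++ unzip2 ((a, b) :: s)) =
  [|| z == a, z == b | z \in unzip1 s ++ unzip2 s].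
Proof.
rewrite !(mem_cat, in_cons) /=.
by case: (z == a); case: (z == b); rewrite ?orbT.
Qed.

Lemma comatching_cons A a b s :
  comatching A ((a, b) :: s) =
  [&& a \in A, b \in A, compl_adj G a b,
      a \notin unzip1 s ++ unzip2 s, b \notin unzip1 s ++ unzip2 s
      & comatching A s].
Proof.
rewrite /comatching.
have -> : uniq (unzip1 ((a, b) :: s) ++ unzip2 ((a, b) :: s)) =
    uniq [:: a, b & unzip1 s ++ unzip2 s].
  by apply: perm_uniq; rewrite /= perm_cons (perm_catCA _ [:: b]).
rewrite /= inE negb_or.
case ab: (compl_adj G a b); last by rewrite !andbF.
have -> : a != b by apply: contraTneq ab => ->; rewrite compl_irrefl.
by case: (a \in A); case: (b \in A); rewrite /= ?andbF -?andbA.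
Qed.

Lemma comatching_size A s : comatching A s -> size s <= #|V|.
Proof.
case/andP=> + _; rewrite cat_uniq => /andP[/card_uniqP us _].
by have := max_card (mem (unzip1 s)); rewrite us size_map.
Qed.

Lemma max_comatching A :
  exists2 s, comatching A s & forall s', comatching A s' -> size s' <= size s.
Proof.
pose P r := [exists t : r.-tuple (V * V), comatching A t].
have P0 : exists r, P r.
  by exists 0; apply/existsP; exists [tuple]; rewrite /comatching.
have Pb r : P r -> r <= #|V|.
  by case/existsP=> t /comatching_size; rewrite size_tuple.
case: (ex_maxnP P0 Pb) => r /existsP[t mt] rmax.
exists t => // s' ms'; rewrite size_tuple; apply: rmax; apply/existsP.
by exists (in_tuple s').
Qed.

Definition covered (s : seq (V * V)) : {set V} :=
  [set x in unzip1 s ++ unzip2 s].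

Lemma card_covered A s : comatching A s -> #|covered s| = (size s).*2.
Proof.
case/andP=> us _; rewrite cardsE (card_uniqP us) size_cat !size_map.
by rewrite addnn.
Qed.

Lemma covered_sub A s : comatching A s -> covered s \subset A.
Proof.
case/andP=> _ /allP As; apply/subsetP => x; rewrite inE mem_cat.
by case/orP=> /mapP[p /As /and3P[? ? _] ->].
Qed.

Section Maximum.
Variables (A : {set V}) (s : seq (V * V)).
Hypothesis (ms : comatching A s).
Hypothesis (smax : forall s', comatching A s' -> size s' <= size s).

Lemma uncovered_clique : clique (A :\: covered s).
Proof.
move=> x y; rewrite !inE => /andP[xs xA] /andP[ys yA] xy.
apply/negPn/negP => nxy.
have := smax (s' := (x, y) :: s).
rewrite comatching_cons xA yA xs ys ms /compl_adj xy nxy /=.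
by move=> /(_ isT); rewrite ltnn.
Qed.

Lemma card_uncovered : #|A :\: covered s| + (size s).*2 = #|A|.
Proof.
rewrite -(card_covered ms) cardsD.
rewrite (setIidPr (covered_sub ms)).
by have := subset_leq_card (covered_sub ms); lia.
Qed.

(* Otherwise the edge [p] could be exchanged for [(p.1, u)] and [(p.2, u')]. *)
Lemma augment p u u' : p \in s -> u \in A :\: covered s ->
  u' \in A :\: covered s -> compl_adj G p.1 u -> compl_adj G p.2 u' -> u = u'.
Proof.
case: p => p1 p2 ps /=; rewrite !inE => /andP[us uA] /andP[us' uA'] pu pu'.
apply/eqP/negPn/negP => uu'.
have pe := perm_to_rem ps; set s1 : seq (V * V) := rem _ s in pe.
have sz : size s = (size s1).+1 by rewrite (perm_size pe).
have mem_pe : unzip1 s ++ unzip2 s =i [:: p1, p2 & unzip1 s1 ++ unzip2 s1].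
  move=> z; rewrite mem_cat (perm_mem (perm_map _ pe)).
  rewrite (perm_mem (perm_map _ pe) z) /= !inE mem_cat.
  by case: (z == p1); case: (z == p2); rewrite ?orbT //= orbT.
move: us us'; rewrite !mem_pe !inE !negb_or.
move=> /and3P[u1 u2 us] /and3P[u1' u2' us'].
move: ms; rewrite (comatching_perm _ pe).
rewrite comatching_cons => /and5P[p1A p2A pp p1s /andP[p2s m1]].
have := smax (s' := [:: (p1, u), (p2, u') & s1]).
have p12 : p1 != p2 by apply: contraTneq pp => ->; rewrite compl_irrefl.
rewrite !comatching_cons !mem_ends_cons !negb_or p1A p2A uA uA' pu pu' m1.
rewrite us us' p1s p2s u2 uu' p12 (eq_sym p1) u1' sz /=.
by move=> /(_ isT); rewrite ltnn.
Qed.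
End Maximum.

(** The clique is what a maximum matching leaves uncovered: two non-adjacent uncovered vertices
    would enlarge the matching. *)
Lemma large_clique k (A : {set V}) :
  (forall s, comatching A s -> size s <= k) ->
  exists2 U : {set V}, U \subset A & clique U /\ #|A| <= #|U| + k.*2.
Proof.
move=> hk; have [s ms smax] := max_comatching A.
exists (A :\: covered s); first exact: subsetDl.
split; first exact: uncovered_clique.
by have := card_uncovered ms; have := hk s ms; lia.
Qed.

End Neighbourhoods.

Lemma subset_of_card (V : finType) (A : {set V}) r : r <= #|A| ->
  exists2 B : {set V}, B \subset A & #|B| = r.
Proof.
elim: r => [|r IH] rA; first by exists set0; rewrite ?sub0set ?cards0.
have [B BA cB] := IH (ltnW rA).
have /card_gt0P[x] : 0 < #|A :\: B|.
  by rewrite cardsD (setIidPr BA) cB subn_gt0.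
rewrite inE => /andP[xB xA]; exists (x |: B).
  by rewrite subUset sub1set xA.
by rewrite cardsU1 xB cB.
Qed.

Lemma fan_of_comatching (V : finType) (G : sgraph V) k x s :
  comatching G (conb G x) s -> k < size s -> subgraph_of (fan k.+1) (compl G).
Proof.
move=> ms ks.
have /andP[us /allP hs] := ms.
pose g (o : option ('I_k.+1 * bool)) := if o is Some (i, b) then
  (if b then (nth (x, x) s i).2 else (nth (x, x) s i).1) else x.
have ns (i : 'I_k.+1) : nth (x, x) s i \in s by apply: mem_nth; apply: leq_trans (ltn_ord i) ks.
have gx o : o != None -> g o \in conb G x.
  by case: o => // -[i b] _ /=; have /and3P[] := hs _ (ns i); case: b.
(* The images of the matching vertices are entries of one duplicate-free list, so injectivity
   becomes an equality of indices. *)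
have gN i b : g (Some (i, b)) =
    nth x (unzip1 s ++ unzip2 s) (if b then size s + i else i).
  have ik : i < size s := leq_trans (ltn_ord i) ks.
  rewrite /= nth_cat size_map; case: b.
    by rewrite ltnNge leq_addr /= addKn (nth_map (x, x)).
  by rewrite ik (nth_map (x, x)).
exists g; split.
  move=> [[i b]|] [[j c]|] // e.
  - move: e; rewrite !gN => /eqP; rewrite nth_uniq //; last first.
    + by rewrite size_cat !size_map; have := ltn_ord j; case: c; lia.
    + by rewrite size_cat !size_map; have := ltn_ord i; case: b; lia.
    have := ltn_ord j; have := ltn_ord i.
    case: b; case: c => ? ? /eqP ij; try lia; congr (Some (_, _)); apply: val_inj => /=; lia.
  - by have := gx (Some (i, b)) isT; rewrite e /= conb_irr.
  - by have := gx (Some (j, c)) isT; rewrite -e /= conb_irr.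
move=> [[i b]|] [[j c]|] //.
- move=> /andP[/eqP <- bc]; have /and3P[_ _ h] := hs _ (ns i).
  move: bc; rewrite /adj /g -/(adj _).
  by case: b; case: c => //= _; rewrite /adj /= // compl_sym.
- by move=> _; have := gx (Some (i, b)) isT; rewrite inE compl_sym.
- by move=> _; have := gx (Some (j, c)) isT; rewrite inE.
Qed.

(** * Greedy embeddings *)

(** Greedy choice: apart from the values on [D0], the other vertices of [D] block fewer than [#|D|]
    candidates. *)
Lemma distinct_representatives (T V : finType) (D0 D : {set T}) (f : T -> V)
    (F : T -> {set V}) :
  [disjoint D0 & D] -> {in D0 &, injective f} ->
  {in D, forall y, #|D| <= #|F y :\: f @: D0|} ->
  exists g : T -> V, [/\ {in D0, g =1 f}, {in D0 :|: D &, injective g}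
    & {in D, forall y, g y \in F y}].
Proof.
have [r] := ubnP #|D|; elim: r D => // r IH D cDr dis injf hF.
have [->|[y yD]] := set_0Vmem D.
  by exists f; split=> //; rewrite ?setU0 // => y; rewrite inE.
have cD : #|D| = #|D :\ y|.+1 by rewrite (cardsD1 y) yD.
have [||||g [g0 ginj gF]] := IH (D :\ y).
- by rewrite -ltnS -cD.
- by apply: disjointWr dis; apply: subsetDl.
- by [].
- by move=> z; rewrite inE => /andP[_ zD]; apply: leq_trans (hF z zD); rewrite cD.
have gD0 : g @: D0 = f @: D0 by apply: eq_in_imset.
have /card_gt0P[v] : 0 < #|F y :\: g @: (D0 :|: D :\ y)|.
  rewrite imsetU gD0 -setDDl.
  have := hF y yD; have : #|g @: (D :\ y)| <= #|D :\ y| by apply: leq_imset_card.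
  rewrite cD.
  have := cardsD (F y :\: f @: D0) (g @: (D :\ y)).
  have := subset_leq_card (subsetIr (F y :\: f @: D0) (g @: (D :\ y))).
  lia.
rewrite inE => /andP[vN vF].
have yD0 : y \notin D0 by apply: contraTN yD => /(disjointFr dis) ->.
exists (fun z => if z == y then v else g z); split.
- by move=> z zD0; case: eqP => [zy|_]; [rewrite -zy zD0 in yD0 | apply: g0].
- have sub z : z \in D0 :|: D -> z != y -> z \in D0 :|: D :\ y.
    by rewrite !inE => /orP[->|-> ->]; rewrite ?orbT.
  move=> a b aD bD; case: (altP (a =P y)) => [->|ay]; case: (altP (b =P y)) => [->|by'] //.
  + by move=> vg; case/imsetP: vN; exists b; rewrite ?sub.
  + by move=> vg; case/imsetP: vN; exists a; rewrite ?sub.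
  + by apply: ginj; rewrite sub.
- by move=> z zD; case: (altP (z =P y)) => [->|zy] //; apply: gF; rewrite !inE zy.
Qed.

(* Otherwise [k.+1] vertices of [D] are greedily matched into [E], giving a fan
   with centre [x]. *)
Lemma fanfree_bipartite (V : finType) (G : sgraph V) k x (D E : {set V}) :
  fanfree G k -> D \subset conb G x -> E \subset conb G x -> [disjoint D & E] ->
  {in D, forall d, k < #|conb G d :&: E|} -> #|D| <= k.
Proof.
move=> ff DN EN dis hD; rewrite leqNgt; apply/negP => kD.
have [D' D'D cD'] := subset_of_card kD.
have := @distinct_representatives V V set0 D' id (fun d => conb G d :&: E).
case=> [||d dD'|g [_ + gF]].
- by rewrite -setI_eq0 set0I.
- by move=> ? ?; rewrite inE.
- by rewrite imset0 setD0 cD'; apply/hD/(subsetP D'D).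
rewrite set0U => ginj.
have gE d : d \in D' -> (g d \in E) /\ compl_adj G d (g d).
  by move=> /gF; rewrite !inE => /andP[].
suff /ff : comatching G (conb G x) [seq (d, g d) | d <- enum D'].
  by rewrite size_map -cardE cD' ltnn.
apply/andP; split; last first.
  apply/allP => p /mapP[d]; rewrite mem_enum => dD' -> /=.
  have [gd ->] := gE d dD'; rewrite (subsetP DN) ?(subsetP D'D) //=.
  by rewrite (subsetP EN).
rewrite /unzip1 /unzip2 -!map_comp cat_uniq map_id_in // enum_uniq /=.
apply/andP; split.
  apply/hasPn => z /mapP[d]; rewrite mem_enum => dD' -> /=; rewrite mem_enum.
  have [gd _] := gE d dD'; apply: contraTN gd => /(subsetP D'D) gD.
  by rewrite (disjointFr dis).
rewrite map_inj_in_uniq ?enum_uniq // => a b; rewrite !mem_enum.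
exact: ginj.
Qed.

Section Embedding.
Variables (T V : finType) (H : sgraph T) (G : sgraph V).

Definition embeds (S : {set T}) (f : T -> V) :=
  {in S &, injective f} /\ {in S &, forall x y, adj H x y -> adj G (f x) (f y)}.

Lemma embedsT f : embeds setT f -> subgraph_of H G.
Proof.
case=> inj hom; exists f; split=> [x y|x y]; first by apply: inj; rewrite inE.
by apply: hom; rewrite inE.
Qed.

(** Pendant vertices are attached one at a time. The trees hanging on the cycle of a unicyclic graph
    arise in this way, and the order of attachment serves as the order of a greedy embedding. *)
Inductive grows (A : {set T}) : {set T} -> Prop :=
| grows_refl : grows A A
| grows_step B x y : grows A B -> x \notin B -> nb H x :&: B = [set y] ->
    grows A (x |: B).

Lemma grows_sub A B : grows A B -> A \subset B.
Proof. by elim=> // C x y _ sAC _ _; rewrite subsetU // sAC orbT. Qed.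

Lemma grows_trans A B C : grows A B -> grows B C -> grows A C.
Proof.
move=> AB; elim=> // D x y _ AD xD xy; exact: grows_step AD xD xy.
Qed.

Lemma grows_nb A B x : grows A B -> x \in B -> x \notin A -> #|nb H x :&: A| <= 1.
Proof.
elim=> [|C z y sAC IH zC zy]; first by move=> ->.
rewrite !inE => /orP[/eqP->|xC] xA; last exact: IH.
by rewrite -(cards1 y) -zy; apply/subset_leq_card/setIS/grows_sub.
Qed.

Lemma grow_embed (A B : {set T}) (good : T -> {set V}) f :
  grows A B -> embeds A f ->
  (forall (S : {set T}) g x y, A \subset S -> S \subset B -> embeds S g ->
     {in A, g =1 f} -> {in S :\: A, forall z, g z \in good z} ->
     x \in B -> x \notin S -> y \in S -> adj H x y -> nb H x :&: S = [set y] ->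
     exists2 v, v \in nb G (g y) :&: good x & v \notin g @: S) ->
  exists g, [/\ embeds B g, {in A, g =1 f}
    & {in B :\: A, forall z, g z \in good z}].
Proof.
move=> AB ef; elim: AB => [|C x y sAC IH xC xy] step.
  by exists f; split=> // z; rewrite inE andNb.
have CB : C \subset x |: C by apply: subsetUr.
have [|g [eg gf gg]] := IH.
  move=> S g z w AS SC eg gf gg zC *; apply: (step S g z w) => //.
    exact: subset_trans SC CB.
  exact: (subsetP CB).
have /setIP[xy' yC] : y \in nb H x :&: C by rewrite xy inE.
have axy : adj H x y by rewrite -in_nb.
have [v] := step C g x y (grows_sub sAC) CB eg gf gg (setU11 x C) xC yC axy xy.
move=> /setIP[gyv vgood] vN.
pose g' z := if z == x then v else g z.
have g'C z : z \in C -> g' z = g z.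
  by move=> zC; rewrite /g'; case: eqP zC xC => // -> ->.
have g'x : g' x = v by rewrite /g' eqxx.
exists g'; split; last first.
- move=> z; rewrite !inE => /andP[zA /orP[/eqP->|zC]]; first by rewrite g'x.
  by rewrite g'C //; apply: gg; rewrite !inE zA.
- by move=> z zA; rewrite g'C ?gf // (subsetP (grows_sub sAC)).
have ne z : z \in C -> v != g z.
  by move=> zC; apply: contraNneq vN => ->; apply: imset_f.
have hx z : z \in C -> adj H x z -> adj G v (g z).
  move=> zC xz; have : z \in nb H x :&: C by rewrite !inE xz.
  by rewrite xy inE => /eqP->; rewrite adj_sym -in_nb.
split=> a b; rewrite !inE.
  move=> /orP[/eqP->|aC] /orP[/eqP->|bC] //; rewrite ?g'x ?g'C //.
  - by move=> /eqP; rewrite (negbTE (ne _ bC)).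
  - by move=> /esym/eqP; rewrite (negbTE (ne _ aC)).
  - by apply: eg.1.
move=> /orP[/eqP->|aC] /orP[/eqP->|bC]; rewrite ?g'x ?g'C ?adj_irrefl //.
- exact: hx.
- by rewrite adj_sym (adj_sym G); apply: hx.
- exact: eg.2.
Qed.

Lemma slot_embedding (v0 : V) (U Z : {set V}) (S I W : {set T}) (L : {set V}) c e :
  clique G U -> [disjoint Z & U] -> L \subset U ->
  I \subset S -> {in I, forall x, nb H x \subset S} -> {in I &, forall x y, ~~ adj H x y} ->
  {in I, forall x, #|nb H x| <= 2} -> (forall y, #|nb H y :&: I| <= c) ->
  W \subset S -> {in I, forall x, [disjoint x |: nb H x & W]} ->
  #|W| <= #|L| -> #|I| = #|Z| -> #|S| <= #|U| + #|Z| ->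
  {in Z, forall z, #|conb G z :&: U| <= e} ->
  c * e + #|I|.*2 + #|W| <= #|U| ->
  exists f, [/\ embeds S f, {in I, forall x, f x \in Z},
    {in S :\: I, forall x, f x \in U} & {in W, forall x, f x \in L}].
Proof.
move=> cU ZU LU IS NIS indep deg2 hc WS IW cW IZ cS he hce.
pose N := (\bigcup_(x in I) nb H x).
have NS : N \subset S by apply/bigcupsP.
have NP y : y \in N -> exists2 x, x \in I & adj H x y.
  by case/bigcupP=> x xI; rewrite in_nb; exists x.
have cN : #|N| <= #|I|.*2.
  rewrite -muln2 -sum_nat_const.
  apply: leq_trans (_ : \sum_(x in I) #|nb H x| <= _); last first.
    by apply: leq_sum => x; apply: deg2.
  by rewrite /N; elim/big_rec2: _ => [|x n A _ h]; rewrite ?cards0 // cardsU; lia.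
have NI : [disjoint N & I].
  rewrite disjoints_subset; apply/subsetP => y /NP[x xI xy]; rewrite inE.
  by apply: contraL xy => yI; apply: indep.
have IWd : [disjoint I & W].
  rewrite disjoints_subset; apply/subsetP => x xI; rewrite inE.
  by rewrite (disjointFr (IW x xI)) // !inE eqxx.
have NW : [disjoint W & N].
  rewrite disjoint_sym disjoints_subset; apply/subsetP => y /NP[x xI xy].
  by rewrite inE (disjointFr (IW x xI)) // !inE xy orbT.
have [||d dI|f1 [_ + f1Z]] :=
  @distinct_representatives T V set0 I (fun=> v0) (fun=> Z).
- by rewrite -setI_eq0 set0I.
- by move=> ? ?; rewrite inE.
- by rewrite imset0 setD0 IZ.
rewrite set0U => f1inj.
have f1IZ : f1 @: I \subset Z by apply/subsetP => _ /imsetP[x xI ->]; apply: f1Z.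
have offI (B : {set V}) : B \subset U -> B :\: f1 @: I = B.
  move=> BU; apply/setDidPl; rewrite disjoint_sym.
  by apply: disjointWl f1IZ _; apply: disjointWr BU _.
have [|||f2 [f21 f2inj f2L]] :=
  @distinct_representatives T V I W f1 (fun=> L).
- by [].
- by [].
- by move=> y _; rewrite offI.
have f2I : f2 @: (I :|: W) \subset f1 @: I :|: L.
  rewrite imsetU subUset; apply/andP; split; apply/subsetP => _ /imsetP[x xI ->].
    by rewrite inE f21 ?imset_f.
  by rewrite inE f2L ?orbT.
(* At most [c] slots are adjacent to [y], and each excludes at most [e] vertices of [U]; [W] and [N]
   use up at most [#|W| + #|I|.*2] more. *)
pose F y := U :\: \bigcup_(x in nb H y :&: I) conb G (f1 x).
have cF y : #|U| - c * e <= #|F y|.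
  rewrite cardsD leq_sub2l //; apply: leq_trans (_ : #|nb H y :&: I| * e <= _).
    rewrite -sum_nat_const.
    apply: leq_trans (_ : \sum_(x in nb H y :&: I) #|conb G (f1 x) :&: U| <= _).
      rewrite setIC; elim/big_rec2: _ => [|x n A _ h].
        by rewrite set0I cards0.
      by rewrite setIUl cardsU; clear -h; lia.
    by apply: leq_sum => x /setIP[_ /f1Z]; apply: he.
  by rewrite leq_mul2r hc orbT.
have [|||f3 [f32 f3inj f3F]] :=
  @distinct_representatives T V (I :|: W) N f2 F.
- by rewrite disjoints_subset subUset -!disjoints_subset NW disjoint_sym NI.
- by [].
- move=> y yN; have := leq_trans (subset_leq_card f2I) (leq_card_setU _ _).
  have -> : F y :\: f2 @: (I :|: W) = F y :\: f2 @: W.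
    rewrite imsetU (_ : f2 @: I = f1 @: I) -?setDDl; last exact: eq_in_imset.
    by rewrite offI ?subsetDl.
  move=> _; have : #|f2 @: W| <= #|W| by apply: leq_imset_card.
   have := cF y.
  have := cardsD (F y) (f2 @: W).
  have := subset_leq_card (subsetIr (F y) (f2 @: W)); clear -hce cN; lia.
pose D0 := I :|: W :|: N; pose D := S :\: D0.
have D0S : D0 \subset S by rewrite !subUset IS WS NS.
have [||y yD|f [f3f finj fU]] :=
  @distinct_representatives T V D0 D f3 (fun=> U).
- by rewrite disjoint_sym disjoints_subset subsetDr.
- exact: f3inj.
- have f3I : f3 @: I = f1 @: I.
    by apply: eq_in_imset => x xI; rewrite f32 ?f21 // inE xI.
  have -> : U :\: f3 @: D0 = U :\: f3 @: (W :|: N).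
    rewrite /D0 -setUA imsetU f3I -setDDl offI //.
  have : #|f3 @: (W :|: N)| <= #|W :|: N| by apply: leq_imset_card.
  have := subset_leq_card (subsetIr U (f3 @: (W :|: N))).
  rewrite !cardsD (setIidPr D0S).
  have : #|D0| = #|I| + #|W :|: N|.
    rewrite /D0 -setUA cardsU (_ : I :&: _ = set0) ?cards0 ?subn0 //.
    by apply/eqP; rewrite setI_eq0 disjoints_subset setCU subsetI
      -!disjoints_subset IWd disjoint_sym NI.
  by have := subset_leq_card D0S; rewrite /D0; clear -cS IZ; lia.
have SD : S = D0 :|: D by rewrite /D -[LHS](setID S D0) (setIidPr D0S).
have fI x : x \in I -> f x = f1 x.
  by move=> xI; rewrite f3f ?f32 ?f21 // !inE xI.
have fN y : y \in N -> f y \in F y.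
  by move=> yN; rewrite f3f ?f3F // !inE yN !orbT.
have fW y : y \in W -> f y \in L.
  by move=> yW; rewrite f3f ?f32 ?f2L // !inE yW !orbT.
have fSU y : y \in S -> y \notin I -> f y \in U.
  rewrite {1}SD inE => /orP[yD0|yD] yI; last exact: fU.
  move: yD0; rewrite /D0 !in_setU (negbTE yI) => /orP[/fW/(subsetP LU) //|yN].
  by have := fN y yN; rewrite inE => /andP[].
exists f; split=> [|x xI|x|//]; last 2 first.
- by rewrite fI ?f1Z.
- by rewrite inE => /andP[xI xS]; apply: fSU.
split; first by rewrite SD; apply: finj.
have key x y : x \in I -> y \in S -> adj H x y -> adj G (f x) (f y).
  move=> xI yS xy.
  have yN : y \in N by apply/bigcupP; exists x; rewrite // in_nb.
  have := fN y yN; rewrite inE (fI x xI) => /andP[yF yU].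
  have : f y \notin conb G (f1 x).
    by apply: contra yF => yx; apply/bigcupP; exists x; rewrite // inE in_nb adj_sym xy.
  rewrite in_conb negb_and !negbK => /orP[/eqP e1|//].
  by have := f1Z x xI; rewrite e1 => /(disjointFr ZU); rewrite yU.
move=> x y xS yS xy.
case xI: (x \in I); first exact: key.
case yI: (y \in I); first by rewrite adj_sym; apply: key; rewrite // adj_sym.
apply: cU; rewrite ?fSU ?xI ?yI //.
apply: contraTneq (adj_neq xy) => exy; apply/negPn/eqP.
by move: exy; rewrite SD in xS yS *; apply: finj.
Qed.
End Embedding.

(** * Structure of unicyclic graphs *)

Section Unicyclic.
Variables (T : finType) (H : sgraph T).

Definition deg_in (B : {set T}) x := #|nb H x :&: B|.

(** Connectedness of the subgraph induced on [B]. In terms of cuts it passes to [B :\ x] for a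
    pendant vertex [x] without surgery on paths. *)
Definition cut_connected (B : {set T}) := forall A : {set T},
  A \subset B -> A != set0 -> A != B ->
  exists x y, [/\ x \in A, y \in B :\: A & adj H x y].

Definition unicyclic_on (B : {set T}) :=
  [/\ B != set0, cut_connected B & \sum_(x in B) deg_in B x = #|B|.*2].

Lemma deg_inT x : deg_in setT x = #|nb H x|.
Proof. by rewrite /deg_in setIT. Qed.

Lemma deg_in_le B x : deg_in B x <= #|nb H x|.
Proof. exact/subset_leq_card/subsetIl. Qed.

Lemma card_adj_pairs : #|[set p : T * T | adj H p.1 p.2]| = \sum_x #|nb H x|.
Proof.
rewrite -sum1_card (eq_bigl (fun p : T * T => adj H p.1 p.2)); last first.
  by move=> p; rewrite inE.
rewrite -(pair_big_dep xpredT (adj H) (fun _ _ => 1)) /=.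
apply: eq_bigr => x _; rewrite -sum1_card.
by apply: eq_bigl => y; rewrite in_nb.
Qed.

(** This makes the division by 2 in [num_edges] exact, so that the number of edges determines the
    degree sum. *)
Lemma even_adj_pairs : ~~ odd #|[set p : T * T | adj H p.1 p.2]|.
Proof.
set E := [set p | _]; pose lt (p : T * T) := enum_rank p.1 < enum_rank p.2.
have swapK : involutive (fun p : T * T => (p.2, p.1)) by case.
have : #|E :&: [set p | lt p]| = #|E :\: [set p | lt p]|.
  rewrite -(card_imset _ (inv_inj swapK)); apply: eq_card => p.
  rewrite !inE -[p in LHS]swapK (mem_imset _ _ (inv_inj swapK)) !inE /=.
  rewrite (adj_sym H p.2) /lt /= andbC; case pE: (adj H _ _); rewrite ?andbF //.
  rewrite !andbT ltn_neqAle -leqNgt; case: eqP => // /ord_inj/enum_rank_inj e.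
  by rewrite e adj_irrefl in pE.
by rewrite -(cardsID [set p | lt p] E) => ->; rewrite addnn odd_double.
Qed.

Lemma unicyclic_onT : unicyclic H -> 0 < #|T| -> unicyclic_on setT.
Proof.
move=> [conn ne] T0; split.
- by rewrite -card_gt0 cardsT.
- move=> A _ A0 AT; have [x xA] := set0Pn _ A0.
  have [y yA] : exists y, y \notin A.
    have: ~: A != set0 by apply: contraNneq AT => e; rewrite -[A]setCK e setC0.
    by case/set0Pn=> y; rewrite inE; exists y.
  have /connectP[p] := conn x y.
  elim: p x xA => [|z p IH] x xA /=; first by move=> _ e; rewrite e xA in yA.
  move=> /andP[xz pz] yl; case zA: (z \in A); first exact: IH zA pz yl.
  by exists x, z; rewrite !inE zA.
- under eq_bigr do rewrite deg_inT.
  rewrite cardsT (eq_bigl xpredT) => [|x]; last by rewrite inE.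
  rewrite -card_adj_pairs; have := even_adj_pairs; move: ne.
  by rewrite /num_edges; lia.
Qed.

Lemma sum_mem_card (A Q : {set T}) : \sum_(z in A) (z \in Q) = #|A :&: Q|.
Proof.
rewrite -sum1_card big_mkcond [RHS]big_mkcond; apply: eq_bigr => z _.
by rewrite inE; case: (z \in A); case: (z \in Q).
Qed.

Lemma sum_deg_in_remove (B : {set T}) x : x \in B ->
  \sum_(z in B) deg_in B z =
  \sum_(z in B :\ x) deg_in (B :\ x) z + (deg_in B x).*2.
Proof.
move=> xB; rewrite (big_setD1 x) //= addnC -addnn addnA; congr (_ + _).
have -> : \sum_(z in B :\ x) deg_in B z =
    \sum_(z in B :\ x) (deg_in (B :\ x) z + (z \in nb H x)).
  apply: eq_bigr => z zB; rewrite /deg_in (cardsD1 x) addnC.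
  congr (_ + _); first by apply: eq_card => w; rewrite !inE andbCA.
  by rewrite inE xB andbT nb_sym.
rewrite big_split /=; congr (_ + _); rewrite sum_mem_card.
apply: eq_card => z; rewrite !inE; case: eqP => [->|_]; first by rewrite adj_irrefl.
by rewrite andbC.
Qed.

(** By connectedness [x] has exactly one neighbour [y] in [B], so its removal lowers the degree sum
    by 2. A part [A] of [B :\ x] is treated as the cut [x |: A] of [B] if it contains [y], and as
    [A] otherwise. *)
Lemma unicyclic_on_remove B x : unicyclic_on B -> x \in B -> deg_in B x <= 1 ->
  unicyclic_on (B :\ x) /\ grows H (B :\ x) B.
Proof.
move=> [B0 cB sB] xB d1.
have BE : x |: (B :\ x) = B by rewrite setD1K.
have Bx : B != [set x].
  apply: contra_eqN sB => /eqP ->; rewrite big_set1 cards1 /deg_in.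
  apply/eqP; have := subset_leq_card (subsetIl (nb H x) [set x]).
  rewrite (_ : _ :&: _ = set0) ?cards0 //; apply/setP=> z; rewrite !inE.
  by case: eqP => [->|]; rewrite ?adj_irrefl ?andbF.
have [y nbx] : exists y, nb H x :&: B = [set y].
  apply/cards1P; rewrite eqn_leq d1 card_gt0.
  have [||| _ [y [/set1P -> yB xy]]] := cB [set x].
  - by rewrite sub1set.
  - by apply/set0Pn; exists x; rewrite inE.
  - by rewrite eq_sym.
  by apply/set0Pn; exists y; move: yB; rewrite !inE xy => /andP[].
have nbx' : nb H x :&: (B :\ x) = [set y].
  rewrite -nbx; apply/setP=> z; rewrite !inE.
  by case: eqP => [->|//]; rewrite adj_irrefl.
split; last first.
  rewrite -{2}BE; apply: grows_step (grows_refl _ _) _ nbx'.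
  by rewrite !inE eqxx.
split.
- by apply: contraNneq Bx => e; rewrite -BE e setU0.
- move=> A AB A0 AN.
  have xA : x \notin A.
    by apply: contraTN AB => xA; apply/subsetPn; exists x; rewrite ?inE ?eqxx.
  have AB' : A \subset B := subset_trans AB (subsetDl _ _).
  case yA: (y \in A).
    have [||| u [w [uA wB uw]]] := cB (x |: A).
    + by rewrite subUset sub1set xB.
    + by apply/set0Pn; exists x; rewrite !inE eqxx.
    + by apply: contraNneq AN => <-; rewrite setU1K.
    move: wB; rewrite !inE negb_or => /andP[/andP[wx wA] wB].
    have uA' : u \in A.
      case/setU1P: uA => // ux; rewrite ux in uw.
      have : w \in nb H x :&: B by rewrite !inE uw.
      by rewrite nbx inE => /eqP wy; rewrite wy yA in wA.
    by exists u, w; rewrite !inE wA wx.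
  have [||| u [w [uA wB uw]]] := cB A => //.
    by apply: contraNneq xA => ->.
  exists u, w; rewrite uA uw; split=> //.
  move: wB; rewrite !inE => /andP[-> wB]; rewrite wB andbT /=.
  apply: contraFneq yA => wx.
  have : u \in nb H x :&: B by rewrite !inE adj_sym -wx uw (subsetP AB').
  by rewrite nbx inE => /eqP <-.
- move: sB; rewrite (sum_deg_in_remove xB) (cardsD1 x) xB /deg_in nbx cards1.
  lia.
Qed.

(** Vertices of degree at most 1 outside [X] are removed as long as there are any. For [X = set0]
    the cycle remains, for [X = [set p]] the cycle and the path from it to [p]. *)
Lemma peel (X B : {set T}) : unicyclic_on B -> X \subset B -> exists S : {set T},
  [/\ X \subset S, grows H S B, unicyclic_on S
    & {in S, forall x, x \notin X -> 1 < deg_in S x}].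
Proof.
have [r] := ubnP #|B|; elim: r B => // r IH B cB uB XB.
have [h|] := boolP [forall x in B, (x \notin X) ==> (1 < deg_in B x)].
  exists B; split=> //; first exact: grows_refl.
  by move=> x xB xX; move/forall_inP: h => /(_ x xB)/implyP/(_ xX).
rewrite negb_forall_in => /exists_inP[x xB]; rewrite negb_imply -leqNgt => /andP[xX d1].
have [uB' gB'] := unicyclic_on_remove uB xB d1.
have [|||S [XS gS uS dS]] := IH (B :\ x).
- by move: cB; rewrite (cardsD1 x) xB.
- by [].
- by apply/subsetP => z zX; rewrite !inE (subsetP XB) // andbT; apply: contraTneq zX => ->.
by exists S; split=> //; apply: grows_trans gB'.
Qed.

Lemma deg_in_eq2 C : unicyclic_on C -> {in C, forall x, 1 < deg_in C x} ->
  {in C, forall x, deg_in C x = 2}.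
Proof.
move=> [_ _ sC] h x xC; apply/eqP; rewrite eqn_leq h // andbT.
move: sC; rewrite (big_setD1 x) //= (cardsD1 x) xC.
have : #|C :\ x| * 2 <= \sum_(z in C :\ x) deg_in C z.
  by rewrite -sum_nat_const; apply: leq_sum => z; rewrite inE => /andP[_ /h].
lia.
Qed.

Lemma deg_in_le2 S p : unicyclic_on S -> p \in S ->
  {in S, forall x, x \notin [set p] -> 1 < deg_in S x} -> deg_in S p <= 2.
Proof.
move=> [_ _ sC] xC h.
move: sC; rewrite (big_setD1 p) //= (cardsD1 p) xC.
have : #|S :\ p| * 2 <= \sum_(z in S :\ p) deg_in S z.
  rewrite -sum_nat_const; apply: leq_sum => z; rewrite inE => /andP[zp zS].
  exact: h.
lia.
Qed.

Lemma deg2_nb (C : {set T}) u a b w : deg_in C u = 2 -> a \in C -> b \in C -> w \in C ->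
  adj H u a -> adj H u b -> adj H u w -> a != b -> w = a \/ w = b.
Proof.
move=> d aC bC wC ua ub uw ab.
have e : [set a; b] = nb H u :&: C.
  apply/eqP; rewrite eqEcard subUset !sub1set !inE aC bC ua ub /=.
  by rewrite cards2 ab -/(deg_in C u) d.
have : w \in nb H u :&: C by rewrite !inE uw.
by rewrite -e !inE => /orP[]/eqP; auto.
Qed.

(** A longest path in [C] closes up, since all degrees are 2 and both neighbours of its first vertex
    lie on it; by connectedness the resulting cycle is all of [C]. *)
Lemma cyclic_order C x0 : unicyclic_on C -> {in C, forall x, 1 < deg_in C x} ->
  exists s : seq T, [/\ uniq s, s =i C, 2 < size s &
    forall i j, i < size s -> j < size s -> adj H (nth x0 s i) (nth x0 s j) ->
      j = i.+1 %% size s \/ i = j.+1 %% size s].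
Proof.
move=> uC h2; have d2 := deg_in_eq2 uC h2; have [/set0Pn[c0 c0C] cC _] := uC.
pose P r := [exists t : r.-tuple T, [&& sorted (adj H) t, uniq t & all (mem C) t]].
have P1 : exists r, P r.
  by exists 1; apply/existsP; exists [tuple c0]; rewrite /= andbT.
have Pb r : P r -> r <= #|T|.
  case/existsP=> t /and3P[_ /card_uniqP ut _].
  by rewrite -(size_tuple t) -ut; apply: max_card.
case: (ex_maxnP P1 Pb) => r /existsP[t /and3P[st ut /allP tC]] rmax.
have r0 : 0 < r.
  by apply: rmax; apply/existsP; exists [tuple c0]; rewrite /= andbT.
move: (tval t) (size_tuple t) st ut tC => s sr st us sC {t}.
have maxs s' : sorted (adj H) s' -> uniq s' -> all (mem C) s' -> size s' <= size s.
  move=> h ? ?; rewrite sr; apply: rmax; apply/existsP; exists (in_tuple s').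
  by apply/and3P.
have step i : i.+1 < size s -> adj H (nth x0 s i) (nth x0 s i.+1).
  by move=> hi; apply: (sortedP x0 st).
have inC i : i < size s -> nth x0 s i \in C by move=> hi; apply/sC/mem_nth.
have inj i j : i < size s -> j < size s -> nth x0 s i = nth x0 s j -> i = j.
  by move=> hi hj /eqP; rewrite nth_uniq // => /eqP.
have hd : s = nth x0 s 0 :: behead s by case: s sr r0 {st us sC maxs step inC inj} => //= <-.
have first_nb z : z \in C -> adj H (nth x0 s 0) z -> exists2 i, i < size s & z = nth x0 s i.
  move=> zC z0; have [zs|zs] := boolP (z \in s).
    by exists (index z s); rewrite ?index_mem // nth_index.
  suff : size (z :: s) <= size s by rewrite /= ltnn.
  apply: maxs; rewrite /= ?zs ?us ?zC //=; last exact/allP.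
  by rewrite hd /= adj_sym z0 -/(sorted _ (_ :: _)) -hd.
have sz : 2 < size s /\ adj H (nth x0 s 0) (nth x0 s (size s).-1).
  have s0 : 0 < size s by rewrite sr.
  have /eqP/cards2P[a [b [ab e]]] := d2 _ (inC 0 s0).
  have : a \in nb H (nth x0 s 0) :&: C by rewrite e !inE eqxx.
  have : b \in nb H (nth x0 s 0) :&: C by rewrite e !inE eqxx orbT.
  rewrite !inE => /andP[zb bC] /andP[za aC].
  have [i hi ai] := first_nb a aC za; have [j hj bj] := first_nb b bC zb.
  have i0 : i != 0 by apply: contraTneq za => e0; rewrite ai e0 adj_irrefl.
  have j0 : j != 0 by apply: contraTneq zb => e0; rewrite bj e0 adj_irrefl.
  have ij : i != j by apply: contraNneq ab => ij; rewrite ai bj ij.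
  split; first by clear -hi hj i0 j0 ij; lia.
  (* If [l] were not the last index, this vertex would have three neighbours: its two neighbours on
     the path and the first vertex. *)
  have key l : l < size s -> 1 < l -> adj H (nth x0 s 0) (nth x0 s l) -> l = (size s).-1.
    move=> hl l1 al; apply/eqP/negPn/negP => nl.
    have l1s : l.+1 < size s by clear -hl nl; lia.
    have lp : l.-1.+1 = l by clear -l1; lia.
    have A1 : adj H (nth x0 s l) (nth x0 s l.-1).
      by rewrite adj_sym -{2}lp; apply: step; rewrite lp.
    have A0 : adj H (nth x0 s l) (nth x0 s 0) by rewrite adj_sym.
    have hl1 : l.-1 < size s by clear -hl; lia.
    have ne : nth x0 s l.-1 != nth x0 s l.+1.
      by apply/eqP => /inj; rewrite hl1 l1s => /(_ isT isT); clear; lia.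
    have [] := deg2_nb (d2 _ (inC _ hl)) (inC _ hl1) (inC _ l1s) (inC _ s0)
      A1 (step _ l1s) A0 ne.
      by move=> /inj; rewrite s0 hl1 => /(_ isT isT); clear -l1; lia.
    by move=> /inj; rewrite s0 l1s => /(_ isT isT); clear; lia.
  rewrite ai in za; rewrite bj in zb.
  have [i1|i1] := leqP i 1.
    by rewrite -(key j) //; clear -i1 i0 ij j0; lia.
  by rewrite -(key i).
have [sz3 close] := sz.
have nxt i : i < size s -> adj H (nth x0 s i) (nth x0 s (i.+1 %% size s)).
  move=> hi; have [e|ne] := eqVneq i.+1 (size s).
    by rewrite e modnn adj_sym (_ : i = (size s).-1) // -e.
  by rewrite modn_small; [apply: step|]; lia.
have nb2 i z : i < size s -> z \in C -> adj H (nth x0 s i) z ->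
    exists2 j, j < size s & z = nth x0 s j /\ (j = i.+1 %% size s \/ i = j.+1 %% size s).
  move=> hi zC az.
  (* The cyclic predecessor of [i]; it differs from the successor because there are at least 3
     vertices. *)
  pose p := (i + (size s).-1) %% size s.
  have hp : p < size s by rewrite ltn_mod; lia.
  have hn : i.+1 %% size s < size s by rewrite ltn_mod; lia.
  have pE : p.+1 %% size s = i.
    rewrite /p -addn1 modnDml -addnA addn1 prednK; last by rewrite sr.
    by rewrite modnDr modn_small.
  have ap : adj H (nth x0 s i) (nth x0 s p) by rewrite adj_sym -pE nxt.
  have ne : nth x0 s (i.+1 %% size s) != nth x0 s p.
    apply/eqP => /inj; rewrite hn hp => /(_ isT isT) e.
    have : p.+1 %% size s = i by [].
    rewrite -e -addn1 modnDml addn1.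
    have [h|[h|h]] : i.+2 < size s \/ i.+2 = size s \/ i.+1 = size s by clear -hi; lia.
    - by rewrite modn_small //; clear; lia.
    - by rewrite h modnn => i0; clear -h i0 sz3; lia.
    - by rewrite h -addn1 addnC modnDr modn_small; clear -h sz3; lia.
  have [->|->] := deg2_nb (d2 _ (inC _ hi)) (inC _ hn) (inC _ hp) zC (nxt _ hi) ap az ne.
    by exists (i.+1 %% size s) => //; split; [|left].
  by exists p => //; split; [|right].
have sE : s =i C.
  move=> z; apply/idP/idP; first exact: sC.
  apply: contraTT => zs; apply/negP => zC.
  have [||| u [w [uA wB uw]]] := cC [set x in s].
  - by apply/subsetP => u; rewrite inE; apply: sC.
  - by apply/set0Pn; exists (nth x0 s 0); rewrite inE mem_nth // sr.
  - by apply/eqP => e; rewrite -e inE (negbTE zs) in zC.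
  move: uA wB; rewrite !inE => us' /andP[ws wC].
  have hi : index u s < size s by rewrite index_mem.
  have [] := nb2 (index u s) w hi wC; first by rewrite nth_index.
  by move=> j hj [wj _]; rewrite wj mem_nth in ws.
exists s; split=> // i j hi hj aij.
have [j' hj' [e h]] := nb2 i _ hi (inC _ hj) aij.
by rewrite (inj _ _ hj hj' e).
Qed.

End Unicyclic.

(** * Slots: sparse sets of vertices of degree at most 2 *)

Lemma card_bigcup_le (I T : finType) (P : pred I) (F : I -> {set T}) :
  #|\bigcup_(i | P i) F i| <= \sum_(i | P i) #|F i|.
Proof.
elim/big_rec2: _ => [|i m A _ h]; first by rewrite cards0.
by rewrite cardsU; lia.
Qed.

Lemma sum_in_card (T : finType) (A : {set T}) : \sum_x (x \in A) = #|A|.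
Proof.
by rewrite -sum1_card [RHS]big_mkcond; apply: eq_bigr => x _; case: (_ \in _).
Qed.

Lemma greedy_independent (T : finType) (J : {set T}) (r : rel T) c :
  reflexive r -> symmetric r ->
  {in J, forall x, #|[set y | r x y]| <= c} ->
  exists I : {set T}, [/\ I \subset J, #|J| <= c * #|I|
    & {in I &, forall x y, x != y -> ~~ r x y}].
Proof.
move=> rr rs; have [n] := ubnP #|J|; elim: n J => // n IH J cJ hc.
have [->|[x xJ]] := set_0Vmem J.
  by exists set0; rewrite cards0; split=> // x y; rewrite inE.
pose J' := J :\: [set y | r x y].
have cJ' : #|J| <= #|J'| + c.
  rewrite -(cardsID [set y | r x y] J) addnC leq_add2l.
  by apply: leq_trans (hc x xJ); apply/subset_leq_card/subsetIr.
have [||I [IJ cI rI]] := IH J'.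
- apply: leq_trans (_ : #|J| <= _) => //; apply: proper_card.
  apply/properP; split; first exact: subsetDl.
  by exists x; rewrite // !inE rr.
- by move=> y /setDP[yJ _]; apply: hc.
have xI y : y \in I -> ~~ r x y by move=> /(subsetP IJ); rewrite !inE => /andP[].
exists (x |: I); split.
- by rewrite subUset sub1set xJ; apply: subset_trans IJ (subsetDl _ _).
- rewrite cardsU1 (_ : x \notin I); last by apply/negP => /xI; rewrite rr.
  by lia.
- move=> a b; rewrite !inE => /orP[/eqP->|aI] /orP[/eqP->|bI].
  + by rewrite eqxx.
  + by move=> _; apply: xI.
  + by move=> _; rewrite rs; apply: xI.
  + exact: rI.
Qed.

Section Slots.
Variables (T : finType) (H : sgraph T).
Hypothesis uH : unicyclic_on H setT.
Hypothesis T1 : 1 < #|T|.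

Definition leaves : {set T} := [set x | #|nb H x| == 1].
Definition nleaves x := #|nb H x :&: leaves|.

Lemma sum_deg : \sum_x #|nb H x| = #|T|.*2.
Proof.
have [_ _] := uH; rewrite cardsT => <-.
by apply: eq_big => x; rewrite ?inE // deg_inT.
Qed.

Lemma deg_gt0 x : 0 < #|nb H x|.
Proof.
have [_ cH _] := uH.
have [||| y [z [/set1P -> _ xz]]] := cH [set x].
- exact: subsetT.
- by apply/set0Pn; exists x; rewrite inE.
- by apply: contraTneq T1 => e; rewrite -cardsT -e cards1.
by apply/card_gt0P; exists z; rewrite in_nb.
Qed.

(** If all neighbours of [x] were leaves, connectedness would make [H] a star, whose degree sum is
    too small by 2. *)
Lemma nleaves_lt x : nleaves x < #|nb H x|.
Proof.
rewrite ltnNge; apply/negP => h.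
have nl : nb H x \subset leaves.
  have /eqP <- : nb H x :&: leaves == nb H x by rewrite eqEcard subsetIl.
  exact: subsetIr.
have [_ cH _] := uH.
have [/eqP e|ne] := boolP (x |: nb H x == setT).
  have cT : #|T| = #|nb H x|.+1 by rewrite -cardsT -e cardsU1 nb_irr.
  have := sum_deg; rewrite (bigID (mem (x |: nb H x))) /= [X in _ + X]big1.
    rewrite big_setU1 ?nb_irr //= (eq_bigr (fun=> 1)) ?sum1_card; last first.
      by move=> y /(subsetP nl); rewrite inE => /eqP.
    by rewrite cT -addnn; lia.
  by move=> y; rewrite e inE.
have [||| y [z [yN zN yz]]] := cH (x |: nb H x).
- exact: subsetT.
- by apply/set0Pn; exists x; rewrite !inE eqxx.
- exact: ne.
move: zN; rewrite !inE negb_or andbT => /andP[zx zN].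
case/setU1P: yN => [yx|yN]; first by rewrite -yx yz in zN.
move: (subsetP nl y yN); rewrite inE => /cards1P[w nw].
have : x \in nb H y by rewrite -nb_sym.
have : z \in nb H y by rewrite in_nb.
by rewrite nw !inE => /eqP zw /eqP xw; rewrite zw xw eqxx in zx.
Qed.

Lemma leafP x y z : x \in leaves -> adj H x y -> adj H x z -> y = z.
Proof.
rewrite inE => /cards1P[w nw]; rewrite -!in_nb nw !inE.
by move=> /eqP -> /eqP ->.
Qed.

Lemma nleaves_leaf x : x \in leaves -> nleaves x = 0.
Proof. by rewrite inE => /eqP d; have := nleaves_lt x; rewrite d; lia. Qed.

Lemma leaf_indep x y : x \in leaves -> y \in leaves -> ~~ adj H x y.
Proof.
move=> xl yl; apply/negP => xy.
suff : 0 < nleaves x by rewrite nleaves_leaf.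
by apply/card_gt0P; exists y; rewrite inE in_nb xy.
Qed.

Lemma sum_nleaves : \sum_x nleaves x = #|leaves|.
Proof.
transitivity (\sum_x \sum_(y in leaves) (adj H x y : nat)).
  apply: eq_bigr => x _; rewrite /nleaves setIC -sum_mem_card.
  by apply: eq_bigr => y _; rewrite in_nb.
rewrite exchange_big /= -sum1_card; apply: eq_bigr => y.
rewrite inE => /eqP <-; rewrite -[nb H y]setTI -sum_mem_card.
by apply: eq_big => x; rewrite ?inE // adj_sym.
Qed.

(* A vertex is bad if it or a neighbour has degree at least 3; as the degrees sum
   up to [2 * #|T|], there are at most [4 * #|leaves|] bad vertices.  Choosing a
   slot among the others excludes at most 5 of them. *)
Lemma spread_slots k : 17 <= k -> k * k + k + 1 <= #|T| -> #|leaves| <= 2 * k ->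
  exists I : {set T}, [/\ 2 * k < #|I|, {in I, forall x, #|nb H x| <= 2} &
    {in I &, forall x y, x != y -> [disjoint x |: nb H x & y |: nb H y]}].
Proof.
move=> k17 hn hL.
pose inner := [set x | (#|nb H x| <= 2) && [forall y in nb H x, #|nb H y| <= 2]].
have cO : #|~: inner| <= 4 * #|leaves|.
  have sub : ~: inner \subset \bigcup_(v | 2 < #|nb H v|) (v |: nb H v).
    apply/subsetP => x; rewrite !inE negb_and -ltnNge => /orP[hx|].
      by apply/bigcupP; exists x; rewrite // !inE eqxx.
    rewrite negb_forall_in => /exists_inP[y]; rewrite in_nb -ltnNge => xy hy.
    by apply/bigcupP; exists y; rewrite // !inE adj_sym xy orbT.
  have := leq_trans (subset_leq_card sub) (card_bigcup_le _ _).
  move=> /leq_trans; apply.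
  (* Adding [8 * #|T|], which is also four times the degree sum, leaves an inequality at each
     vertex. In degree [d] it is [d + 9 <= 4 * d] for [d >= 3], and an equality for [d = 1] and
     [d = 2]. *)
  rewrite -(leq_add2r (8 * #|T|)).
  have e8 : 8 * #|T| = \sum_(x : T) 8 by rewrite sum_nat_const mulnC.
  have eL : 4 * #|leaves| = \sum_(x : T) 4 * (x \in leaves).
    by rewrite -big_distrr /= sum_in_card.
  have e4 : 8 * #|T| = \sum_(x : T) 4 * #|nb H x|.
    by rewrite -big_distrr /= sum_deg -muln2 mulnCA mulnC.
  rewrite {2}e4 e8 eL big_mkcond -!big_split /=; apply: leq_sum => x _.
  have := deg_gt0 x; rewrite cardsU1 nb_irr inE.
  by case: ifP; case: eqP; lia.
pose r x y := ~~ [disjoint x |: nb H x & y |: nb H y].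
have [||x|I [IJ cI rI]] := @greedy_independent T inner r 5.
- move=> x; rewrite /r -setI_eq0 setIid; apply/set0Pn; exists x.
  by rewrite !inE eqxx.
- by move=> x y; rewrite /r disjoint_sym.
- rewrite inE => /andP[dx /forall_inP hx].
  (* Excluded by [x] are [x] itself, its at most two neighbours, and at most one further neighbour
     of each of these. *)
  apply: leq_trans (_ : #|x |: \bigcup_(u in nb H x) (u |: (nb H u :\ x))| <= _).
    apply: subset_leq_card; apply/subsetP => y; rewrite inE /r -setI_eq0.
    case/set0Pn=> w /setIP[]; rewrite !inE => wx wy.
    case: eqP => //= /eqP yx; apply/bigcupP.
    case/orP: wx => [/eqP we|xw].
      move: wy; rewrite we eq_sym (negbTE yx) /= => yx'.
      by exists y; rewrite !inE ?eqxx // adj_sym.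
    exists w; rewrite ?in_nb // !inE yx /= eq_sym.
    by case/orP: wy => [->//|]; rewrite adj_sym => ->; rewrite orbT.
  rewrite cardsU1; apply: leq_trans (_ : 1 + 2 * 2 <= _) => //.
  apply: leq_add; first by case: (_ \notin _).
  apply: leq_trans (card_bigcup_le _ _) _.
  apply: leq_trans (_ : \sum_(u in nb H x) 2 <= _); last first.
    by rewrite sum_nat_const leq_mul2r dx orbT.
  apply: leq_sum => u ux; have := hx u ux; have := cardsU1 u (nb H u :\ x).
  by rewrite (cardsD1 x (nb H u)) -nb_sym ux !inE adj_irrefl andbF /=; lia.
exists I; split.
(* Here [k * k - 7 * k + 1 <= #|inner| <= 5 * #|I|], and the left side exceeds [10 * k] from
   [k = 17] on. *)
- have := cardsC inner; nia.
- by move=> x /(subsetP IJ); rewrite inE => /andP[].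
- by move=> x y xI yI /(rI x y xI yI); rewrite /r negbK.
Qed.

(* The slots are three leaves at each vertex having so many, all of them at the
   others, and a third of the vertices of degree 2 with only neighbours of
   degree 2.  The inequality [pw], summed up over all vertices, shows that this
   is enough. *)
Lemma slots3 k : 17 <= k -> k * k + k + 1 <= #|T| -> (forall x, nleaves x < k) ->
  exists I : {set T}, [/\ 2 * k < #|I|, {in I, forall x, #|nb H x| <= 2},
    {in I &, forall x y, ~~ adj H x y} & forall y, #|nb H y :&: I| <= 3].
Proof.
move=> k17 hn hM.
have /fin_all_exists[L hL] (v : T) : exists L : {set T},
    L \subset nb H v :&: leaves /\ #|L| = minn (nleaves v) 3.
  by have [L ? ?] := subset_of_card (geq_minl (nleaves v) 3); exists L.
pose J := [set x | (#|nb H x| == 2) && [forall y in nb H x, #|nb H y| == 2]].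
have [||x|IJ [IJJ cIJ rIJ]] :=
  @greedy_independent T J (fun x y => (x == y) || adj H x y) 3.
- by move=> x; rewrite eqxx.
- by move=> x y; rewrite eq_sym adj_sym.
- rewrite inE => /andP[/eqP dx _].
  apply: leq_trans (_ : #|x |: nb H x| <= _); last by rewrite cardsU1 nb_irr dx.
  apply: subset_leq_card; apply/subsetP => y; rewrite !inE.
  by rewrite eq_sym.
pose IL := \bigcup_v L v.
have ILl v x : x \in L v -> (x \in leaves) && adj H v x.
  by have [/subsetP LS _] := hL v; move=> /LS; rewrite !inE andbC.
have ILv x v : x \in IL -> adj H v x -> x \in L v.
  case/bigcupP=> w _ xw vx; have /andP[xl wx] := ILl _ _ xw.
  by rewrite (@leafP x v w) // adj_sym.
have cIL : #|IL| = \sum_v minn (nleaves v) 3.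
  rewrite -(eq_bigr _ (fun v _ => (hL v).2)) -sum1_card.
  (* A leaf lies in [L v] only for its unique neighbour [v], so the sets [L v] are disjoint and
     [pick] recovers [v]. *)
  rewrite (partition_big (fun x => odflt x [pick v | x \in L v]) xpredT) //=.
  apply: eq_bigr => v _; rewrite -sum1_card; apply: eq_bigl => x.
  apply/andP/idP => [[/bigcupP[w _ xw]]|xv].
    by case: pickP => [u xu /eqP <- //|/(_ w)]; rewrite xw.
  split; first by apply/bigcupP; exists v.
  case: pickP => [u xu /=|/(_ v)]; last by rewrite xv.
  have /andP[xl vx] := ILl _ _ xv; have /andP[_ ux] := ILl _ _ xu.
  by rewrite (@leafP x u v) // adj_sym.
have ILleaf x : x \in IL -> x \in leaves by case/bigcupP=> v _ /ILl/andP[].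
have JJ x y : x \in IJ -> adj H x y -> #|nb H y| = 2.
  move=> /(subsetP IJJ); rewrite inE => /andP[_ /forall_inP h] xy.
  by apply/eqP/h; rewrite in_nb.
have J2 x : x \in IJ -> #|nb H x| = 2.
  by move=> /(subsetP IJJ); rewrite inE => /andP[/eqP].
have LJ x y : x \in IL -> y \in IJ -> ~~ adj H y x.
  move=> /ILleaf; rewrite inE => /eqP d1 yJ; apply/negP => /(JJ _ _ yJ).
  by rewrite d1.
have cI : #|IL :|: IJ| = #|IL| + #|IJ|.
  rewrite cardsU (_ : _ :&: _ = set0) ?cards0 ?subn0 //.
  apply/setP=> x; rewrite !inE; apply/negP => /andP[/ILleaf + /J2].
  by rewrite inE => /eqP ->.
exists (IL :|: IJ); split.
- rewrite cI ltnNge; apply/negP => small.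
  (* A vertex outside [J] that is no leaf is charged to a vertex of degree at least 3 equal or
     adjacent to it, or else to itself for having a leaf as neighbour. *)
  pose Phi v := if 2 < #|nb H v| then v |: (nb H v :\: leaves)
    else if (#|nb H v| == 2) && (0 < nleaves v) then [set v] else set0.
  have sub : ~: J \subset leaves :|: \bigcup_v Phi v.
    apply/subsetP => x; rewrite in_setC in_setU [x \in J]inE negb_and => hx.
    have [//|xl /=] := boolP (x \in leaves).
    have dx : 1 < #|nb H x| by have := deg_gt0 x; move: xl; rewrite inE; lia.
    have [big|nbig] := ltnP 2 #|nb H x|.
      by apply/bigcupP; exists x; rewrite // /Phi big !inE eqxx.
    have d2 : #|nb H x| = 2 by lia.
    move: hx; rewrite d2 eqxx negb_forall_in /=.
    case/exists_inP=> y; rewrite in_nb => xy dy.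
    have [yb|ys] := ltnP 2 #|nb H y|.
      by apply/bigcupP; exists y; rewrite // /Phi yb 2!inE in_setD xl in_nb adj_sym xy orbT.
    have yl : y \in leaves by rewrite inE; have := deg_gt0 y; lia.
    apply/bigcupP; exists x => //; rewrite /Phi d2 /=.
    have -> : 0 < nleaves x by apply/card_gt0P; exists y; rewrite inE yl in_nb xy.
    by rewrite inE.
  have cJ : #|~: J| <= #|leaves| + \sum_v #|Phi v|.
    apply: leq_trans (subset_leq_card sub) _.
    apply: leq_trans (leq_card_setU _ _) _; rewrite leq_add2l.
    exact: card_bigcup_le.
  have pw v : 3 * (#|Phi v| + 5 * nleaves v + 8) <=
      3 * (4 * #|nb H v|) + (k + 5) * minn (nleaves v) 3 + 12 * (v \in leaves).
    have lt := nleaves_lt v; have l0 := @nleaves_leaf v; have d0 := deg_gt0 v.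
    have cP : #|v |: (nb H v :\: leaves)| + nleaves v <= #|nb H v|.+1.
      by rewrite cardsU1 -(cardsID leaves (nb H v)) /nleaves; case: (_ \notin _); lia.
    have lk := hM v; rewrite /Phi; case: ifP => [h|h].
      have -> : (v \in leaves) = false by apply/negP; rewrite inE; lia.
      by have [?|?] := leqP 3 (nleaves v); nia.
    have [e1|e1] := eqVneq #|nb H v| 1.
      have vl : v \in leaves by rewrite inE e1.
      by rewrite e1 vl (l0 vl) cards0; lia.
    have e2 : #|nb H v| = 2 by lia.
    have -> : (v \in leaves) = false by apply/negP; rewrite inE; lia.
    rewrite e2 /=; case: ifP => h0; rewrite ?cards1 ?cards0; nia.
  have : \sum_v 3 * (#|Phi v| + 5 * nleaves v + 8) <= 
      \sum_v (3 * (4 * #|nb H v|) + (k + 5) * minn (nleaves v) 3 + 12 * (v \in leaves)).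
    by apply: leq_sum => v _; apply: pw.
  have -> : \sum_v 3 * (#|Phi v| + 5 * nleaves v + 8) =
      3 * (\sum_v #|Phi v| + 5 * #|leaves| + #|T| * 8).
    rewrite -[LHS]big_distrr 2!big_split /= sum_nat_const -sum_nleaves.
    by rewrite [5 * _]big_distrr.
  have -> : \sum_v (3 * (4 * #|nb H v|) + (k + 5) * minn (nleaves v) 3
        + 12 * (v \in leaves)) = 24 * #|T| + (k + 5) * #|IL| + 12 * #|leaves|.
    rewrite 2!big_split /= cIL -(sum_in_card leaves) !big_distrr /=; congr (_ + _ + _).
    rewrite (eq_bigr (fun v => 12 * #|nb H v|)); last by move=> v _; rewrite mulnA.
    by rewrite -big_distrr /= sum_deg -muln2 mulnCA mulnC.
  (* The summed inequality gives [3 * #|~: J| <= (k + 5) * #|IL|]. With [#|J| <= 3 * #|IJ|], at most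
     [2 * k] slots would force [3 * #|T| <= 2 * k * (k + 5)], which is too small. *)
  have := cardsC J.
  move: cJ cIJ small.
  move: #|J| #|~: J| #|IL| #|IJ| #|leaves| (\sum_v #|Phi v|) #|T| hn.
  move=> J1 J2' a b l phi t; nia.
- move=> x; rewrite inE => /orP[/ILleaf|/J2 -> //].
  by rewrite inE => /eqP ->.
- move=> x y; rewrite !in_setU => /orP[xI|xI] /orP[yI|yI].
  + exact: leaf_indep (ILleaf _ xI) (ILleaf _ yI).
  + by rewrite adj_sym; apply: LJ.
  + exact: LJ.
  + have [->|xy] := eqVneq x y; first by rewrite adj_irrefl.
    by have := rIJ x y xI yI xy; rewrite negb_or => /andP[].
- move=> y; have [e|[x /setIP[yx xJ]]] := set_0Vmem (nb H y :&: IJ).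
    rewrite setIUr e setU0; apply: leq_trans (_ : #|L y| <= _); last first.
      by have [_ ->] := hL y; apply: geq_minr.
    apply: subset_leq_card; apply/subsetP => x; rewrite inE in_nb => /andP[yx xI].
    exact: ILv.
  rewrite in_nb adj_sym in yx; have := JJ _ _ xJ yx.
  by have := subset_leq_card (subsetIl (nb H y) (IL :|: IJ)); lia.
Qed.

End Slots.

(** * Cycles in graphs of large minimum degree *)

Lemma path_rcons_rev (T : Type) (e : rel T) u x y q : symmetric e ->
  path e u (rcons (rev (y :: q)) x) = [&& e u (last y q), path e y q & e y x].
Proof.
move=> es; elim/last_ind: q u x => [|q z IH] u x /=; first by rewrite andbT.
rewrite -rcons_cons rev_rcons /= IH last_rcons rcons_path.
by rewrite (es z); case: (e u z); case: (e _ z); rewrite ?andbF ?andbT.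
Qed.

Section CyclesInGraph.
Variables (V : finType) (G : sgraph V).

Definition is_cycle c (u : nat -> V) :=
  [/\ forall i j, i < c -> j < c -> u i = u j -> i = j,
      forall i, i.+1 < c -> adj G (u i) (u i.+1) & adj G (u c.-1) (u 0)].

(* Rotation of a longest path. *)
Lemma dirac : 1 < #|V| -> (forall x, #|V| < 2 * #|nb G x|) ->
  exists u, is_cycle #|V| u.
Proof.
move=> V1 hd; have /card_gt0P[x0 _] : 0 < #|V| by lia.
pose P r := [exists t : r.-tuple V, sorted (adj G) t && uniq t].
have P1 : exists r, P r by exists 1; apply/existsP; exists [tuple x0].
have Pb r : P r -> r <= #|V|.
  case/existsP=> t /andP[_ /card_uniqP ut].
  by rewrite -(size_tuple t) -ut; apply: max_card.
case: (ex_maxnP P1 Pb) => r /existsP[t /andP[st ut]] rmax.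
have r0 : 0 < r by apply: rmax; apply/existsP; exists [tuple x0].
move: (tval t) (size_tuple t) st ut => s sr st us {t}.
have maxs s' : sorted (adj G) s' -> uniq s' -> size s' <= size s.
  move=> h1 h2; rewrite sr; apply: rmax; apply/existsP; exists (in_tuple s').
  by rewrite h1.
case: s sr st us maxs => [|x p] sr st us maxs; first by rewrite -sr in r0.
have xnb y : adj G x y -> y \in p.
  move=> xy; apply/negPn/negP => yp.
  suff : size (y :: x :: p) <= size (x :: p) by rewrite /= ltnn.
  apply: maxs; first by rewrite /= adj_sym xy.
  by rewrite cons_uniq us inE negb_or yp eq_sym (adj_neq xy).
have lnb y : adj G (last x p) y -> y \in x :: p.
  move=> ly; apply/negPn/negP => yp.
  suff : size (rcons (x :: p) y) <= size (x :: p) by rewrite size_rcons ltnn.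
  apply: maxs; first by rewrite rcons_cons /= rcons_path ly andbT.
  by rewrite rcons_uniq yp.
have p0 : 0 < size p.
  have /card_gt0P[y] : 0 < #|nb G x| by have := hd x; lia.
  by rewrite in_nb => /xnb; case: (p).
pose v i := nth x0 (x :: p) i.
(* An index [i] in both [A] and [B] closes a cycle: from [x] along the path to [v i], across to the
   last vertex, and back along the path to [v i.+1], which is adjacent to [x]. *)
pose A := [set i : 'I_(size p) | adj G x (v i.+1)].
pose B := [set i : 'I_(size p) | adj G (last x p) (v i)].
have cA : #|nb G x| <= #|A|.
  apply: leq_trans (leq_imset_card (fun i : 'I_(size p) => v i.+1) _).
  apply/subset_leq_card/subsetP => y; rewrite in_nb => xy; have yp := xnb y xy.
  have hi : index y p < size p by rewrite index_mem.
  apply/imsetP; exists (Ordinal hi); rewrite ?inE /v /= nth_index //.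
have cB : #|nb G (last x p)| <= #|B|.
  apply: leq_trans (leq_imset_card (fun i : 'I_(size p) => v i) _).
  apply/subset_leq_card/subsetP => y; rewrite in_nb => ly; have yp := lnb y ly.
  have hi : index y (x :: p) < size p.
    have : index y (x :: p) < size (x :: p) by rewrite index_mem.
    rewrite ltnS leq_eqVlt => /orP[/eqP e|//].
    have : y = last x p by rewrite -(nth_index x0 yp) e nth_last.
    by move=> yl; rewrite yl adj_irrefl in ly.
  by apply/imsetP; exists (Ordinal hi); rewrite ?inE /v /= nth_index //.
have sp : (size p).+1 <= #|V|.
  by apply: Pb; apply/existsP; exists (in_tuple (x :: p)); apply/andP.
have [i /setIP[]] : exists i, i \in A :&: B.
  apply/set0Pn; rewrite -card_gt0; have := cardsUI A B.
  have := subset_leq_card (subsetT (A :|: B)); rewrite cardsT card_ord.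
  by have := hd x; have := hd (last x p); lia.
rewrite !inE; move: (nat_of_ord i) (ltn_ord i) => {}i ip xvi lvi.
pose p1 := take i p; pose q := drop i.+1 p; pose y := nth x0 p i.
have pE : p = p1 ++ y :: q.
  by rewrite -drop_nth ?cat_take_drop.
have vi : v i = last x p1.
  have s1 : size p1 = i by rewrite size_take ip.
  by rewrite -[RHS]/(last x0 (x :: p1)) -nth_last /= s1 /v pE -cat_cons nth_cat /= s1 ltnSn.
have lE : last x p = last y q by rewrite pE last_cat.
have yE : v i.+1 = y by [].
pose w := x :: p1 ++ rev (y :: q).
have wp : perm_eq w (x :: p).
  by rewrite /w perm_cons pE perm_cat2l perm_rev.
have wc : cycle (adj G) w.
  rewrite /w /= rcons_cat cat_path path_rcons_rev; last exact: adj_sym.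
  move: st; rewrite /= pE cat_path /= => /and3P[-> _ ->].
  by rewrite -lE -vi adj_sym lvi -yE adj_sym xvi.
have wu : uniq w by rewrite (perm_uniq wp).
have ws : size w = #|V|.
  apply/eqP; rewrite eqn_leq (perm_size wp) sp /= leqNgt; apply/negP => small.
  have [z zw] : exists z, z \notin w.
    apply/existsP; rewrite -negb_forall; apply/negP => /forallP all.
    have : #|V| <= size w.
      by rewrite -(card_uniqP wu); apply/subset_leq_card/subsetP => z _; apply: all.
    by rewrite (perm_size wp) /=; lia.
  (* More than half of the vertices lie on the cycle, so [z] has a neighbour [u] there; opening the
     cycle at [u] and prefixing [z] gives a longer path. *)
  have [e|[u /setIP[zu uw]]] := set_0Vmem (nb G z :&: [set u in w]).
    have : nb G z \subset ~: [set u in w] by rewrite -disjoints_subset -setI_eq0 e.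
    move/subset_leq_card; have := cardsC [set u in w].
    rewrite [X in X + _]cardsE (card_uniqP wu) (perm_size wp) /=.
    have : #|A| <= size p.
      by rewrite -[X in _ <= X]card_ord -cardsT subset_leq_card ?subsetT.
    move=> /(leq_trans cA) hx hw hz; have := hd x; have := hd z.
    move: hx hw hz; move: #|nb G x| #|nb G z| #|V| #|~: _| => a1 a2 a3 a4.
    by lia.
  rewrite inE in uw; have [j w' wE] := rot_to uw.
  have : size (z :: u :: w') <= size (x :: p).
    apply: maxs.
      rewrite /= -in_nb zu /=.
      by move: wc; rewrite -(rot_cycle j) wE /= rcons_path => /andP[].
    by rewrite cons_uniq -wE mem_rot zw rot_uniq.
  by rewrite -(perm_size wp) -(size_rot j w) wE /= ltnn.
exists (fun i => nth x0 w i); rewrite -ws; split.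
- by move=> a b ha hb /eqP; rewrite nth_uniq // => /eqP.
- move=> a ha; move: wc; rewrite /w /= rcons_path -/(w) => /andP[ps _].
  exact: (pathP x0 ps).
- move: wc; rewrite /w [cycle _ _]/= rcons_path => /andP[_].
  by rewrite nth_last.
Qed.

(* Bondy: with [x, y] consecutive on a Hamiltonian cycle, a shift of the indices
   maps neighbours of [x] to non-neighbours of [y] unless there is a [c]-cycle. *)
Lemma pancyclic c : (forall x, #|V| < 2 * #|nb G x|) -> 2 < c <= #|V| ->
  exists u, is_cycle c u.
Proof.
move=> hd /andP[c3 cN]; have [|v [vinj vstep vclose]] := dirac _ hd; first by lia.
set N := #|V| in vinj vstep vclose hd cN *.
have vsurj z : exists2 i, i < N & v i = z.
  have inj : injective (fun i : 'I_N => v i).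
    by move=> i j /vinj e; apply/ord_inj/e; rewrite ltn_ord.
  have : z \in codom (fun i : 'I_N => v i).
    by apply: inj_card_onto inj _ _; rewrite card_ord.
  by case/codomP=> i ->; exists i; rewrite ?ltn_ord.
(* A permutation of the indices strictly between 0 and [N.-1]. If [v 0] is adjacent to [v i] and
   [v N.-1] to [v (io i)], there is a [c]-cycle: [v 0], [v i] up to [v (io i)], [v N.-1] in the
   first case; [v 0] up to [v (io i)], then [v N.-1] down to [v i], in the second. *)
pose io i := if i <= N - c + 1 then i + c - 3 else i + c - 1 - N.
pose A := [set i : 'I_N | (0 < i < N.-1) && adj G (v 0) (v i)].
pose B := [set i : 'I_N | (0 < i < N.-1) && adj G (v N.-1) (v (io i))].
have mid l : 0 < N -> l < N -> l != 0 -> l != N.-1 -> 0 < l < N.-1 by lia.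
have cA : #|nb G (v 0)| <= #|A|.+1.
  rewrite -(@leq_add2r 0) (cardsD1 (v N.-1)) !addn0 -[#|A|.+1]add1n leq_add //.
    by case: (_ \in _).
  apply: leq_trans (leq_imset_card (fun i : 'I_N => v i) _).
  apply/subset_leq_card/subsetP => z; rewrite !inE => /andP[zy xz].
  have [i hi vi] := vsurj z; apply/imsetP; exists (Ordinal hi); rewrite //= inE /=.
  rewrite vi xz andbT; apply: mid => //; first lia.
    by apply: contraTneq xz => i0; rewrite -vi i0 adj_irrefl.
  by apply: contraNneq zy => i0; rewrite -vi i0.
have cB : #|nb G (v N.-1)| <= #|B|.+1.
  rewrite -(@leq_add2r 0) (cardsD1 (v 0)) !addn0 -[#|B|.+1]add1n leq_add //.
    by case: (_ \in _).
  apply: leq_trans (leq_imset_card (fun i : 'I_N => v (io i)) _).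
  apply/subset_leq_card/subsetP => z; rewrite !inE => /andP[zy xz].
  have [l hl vl] := vsurj z.
  have /andP[l0 lN] : 0 < l < N.-1.
    apply: mid => //; first lia.
      by apply: contraNneq zy => i0; rewrite -vl i0.
    by apply: contraTneq xz => i0; rewrite -vl i0 adj_irrefl.
  pose i := if c - 2 <= l then l - (c - 3) else l + N + 1 - c.
  have hi : i < N by rewrite /i; case: ifP; lia.
  have ioi : io i = l by rewrite /io /i; case: (leqP (c - 2) l); case: ifP; lia.
  apply/imsetP; exists (Ordinal hi); rewrite ?inE /= ioi // vl xz andbT.
  by rewrite /i; case: ifP; lia.
have [i /setIP[]] : exists i, i \in A :&: B.
  apply/set0Pn; rewrite -card_gt0; have := cardsUI A B.
  have sub : A :|: B \subset [set i : 'I_N | 0 < i < N.-1].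
    by apply/subsetP => i; rewrite !inE => /orP[] /andP[].
  have := subset_leq_card sub.
  have -> : #|[set i : 'I_N | 0 < i < N.-1]| = N - 2.
    have h0 : 0 < N by lia.
    have h1 : N.-1 < N by lia.
    have -> : [set i : 'I_N | 0 < i < N.-1] = ~: [set Ordinal h0; Ordinal h1].
      apply/setP=> j; rewrite !inE -!val_eqE /= negb_or -lt0n.
      by congr (_ && _); have := ltn_ord j; lia.
    have := cardsC [set Ordinal h0; Ordinal h1]; rewrite cards2 card_ord.
    by rewrite -val_eqE /= (_ : 0 != N.-1); lia.
  by have := hd (v 0); have := hd (v N.-1); lia.
rewrite !inE => /andP[/andP[i0 iN] xi] /andP[_]; rewrite /io.
have vstep' j : j.+1 < N -> adj G (v j.+1) (v j) by rewrite adj_sym; apply: vstep.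
case: ifP => hi yi.
  pose ka t := if t == 0 then 0 else if t == c.-1 then N.-1 else i + t - 1.
  exists (fun t => v (ka t)); split.
  - move=> a b ha hb /vinj; rewrite /ka.
    by case: (eqVneq a 0); case: (eqVneq a c.-1); case: (eqVneq b 0);
       case: (eqVneq b c.-1) => ? ? ? ?; (try lia); move=> h; have := h; lia.
  - move=> t ht; rewrite /ka /= (_ : (t == c.-1) = false); last lia.
    case: (eqVneq t 0) => [->|t0].
      by rewrite (_ : (1 == c.-1) = false) ?addn1 ?subn1 //; lia.
    case: (eqVneq t.+1 c.-1) => [e|ne].
      by rewrite adj_sym (_ : i + t - 1 = i + c - 3) //; lia.
    have -> : i + t.+1 - 1 = (i + t - 1).+1 by lia.
    by apply: vstep; lia.
  - rewrite /ka eqxx (_ : (c.-1 == 0) = false) //; lia.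
set a := i + c - 1 - N in yi.
pose ka t := if t <= a then t else N + a - t.
exists (fun t => v (ka t)); split.
- move=> s t hs ht /vinj; rewrite /ka.
  by case: ifP => ?; case: ifP => ?; move=> h; have := h; lia.
- move=> t ht; rewrite /ka; case: (ltngtP t a) => h.
  + by apply: vstep; lia.
  + rewrite (_ : N + a - t = (N + a - t.+1).+1); last lia.
    by apply: vstep'; lia.
  + by rewrite h adj_sym (_ : N + a - a.+1 = N.-1) //; lia.
- rewrite /ka leq0n (_ : (c.-1 <= a) = false); last lia.
  by rewrite adj_sym (_ : N + a - c.-1 = i) //; lia.
Qed.

Lemma cycle_embedding (T : finType) (H : sgraph T) x0 (s : seq T) (C : {set T}) u :
  s =i C -> 1 < size s ->
  (forall i j, i < size s -> j < size s -> adj H (nth x0 s i) (nth x0 s j) ->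
      j = i.+1 %% size s \/ i = j.+1 %% size s) ->
  is_cycle (size s) u -> embeds H G C (fun z => u (index z s)).
Proof.
move=> sC s1 h [uinj ustep uclose].
have unext i : i < size s -> adj G (u i) (u (i.+1 %% size s)).
  move=> hi; have [e|ne] := eqVneq i.+1 (size s).
    by rewrite e modnn (_ : i = (size s).-1) // -e.
  by rewrite modn_small; [apply: ustep|]; lia.
split=> x y; rewrite -!sC => xs ys.
  move=> /uinj; rewrite !index_mem => /(_ xs ys) e.
  by rewrite -(nth_index x0 xs) e nth_index.
move=> xy; have := h (index x s) (index y s).
rewrite !index_mem !nth_index // => /(_ xs ys xy)[->|->]; first by rewrite unext ?index_mem.
by rewrite adj_sym unext ?index_mem.
Qed.

End CyclesInGraph.

(** * A vertex of degree at least n - 1 *)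

(** The linear form of the bound on [n], for use by [lia]; at [k = 17] it compares 306 with 307. *)
Lemma quadratic_ge k n : 17 <= k -> k * k + k + 1 <= n -> 18 * k <= n.
Proof. by nia. Qed.

Section LargeDegree.
Variables (V : finType) (G : sgraph V) (k n : nat).
Hypothesis ff : fanfree G k.
Hypothesis cV : #|V| + 1 = 2 * n.
Hypothesis k17 : 17 <= k.
Hypothesis nk : k * k + k + 1 <= n.
Hypothesis small_degrees : forall x, #|nb G x| + 2 <= n.

Lemma codegree_ge x : n <= #|conb G x|.
Proof. by have := card_nb_conbT G x; have := small_degrees x; lia. Qed.

Let n18 : 18 * k <= n := quadratic_ge k17 nk.

(* Morally, these vertices are on the same side as [v]. *)
Definition misplaced v : {set V} :=
  [set x in conb G v | #|conb G x :\: conb G v| < 3 * k].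

Definition well_placed v := conb G v :\: misplaced v.

Lemma misplaced_codeg v x : x \in misplaced v ->
  n < #|conb G x :&: conb G v| + 3 * k.
Proof.
rewrite inE => /andP[_ h]; have := codegree_ge x.
by have := cardsID (conb G v) (conb G x); lia.
Qed.

(** A misplaced vertex has more than [n - 3 * k] non-neighbours in [conb G v], so [s] can be
    extended by an edge at each of them, and the extended matching still has size at most [k]. *)
Lemma well_placed_nu v s : comatching G (well_placed v) s ->
  size s + #|misplaced v| <= k.
Proof.
move=> ms; rewrite leqNgt; apply/negP => big.
have msA : comatching G (conb G v) s := comatchingS (subsetDl _ _) ms.
have sk := ff msA.
have [X XX cX] := @subset_of_card _ (misplaced v) (k.+1 - size s) ltac:(lia).
have Xs x : x \in X -> x \notin unzip1 s ++ unzip2 s.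
  move=> xX; have : x \notin covered s.
    apply/negP => /(subsetP (covered_sub ms)).
    by rewrite inE (subsetP XX).
  by rewrite inE.
pose F x := (conb G x :&: conb G v) :\: (covered s :|: X).
have [|||g [_ + gF]] := @distinct_representatives V V set0 X id F.
- by rewrite -setI_eq0 set0I.
- by move=> ? ?; rewrite inE.
- move=> x xX; rewrite imset0 setD0 cX /F cardsD.
  have := misplaced_codeg (subsetP XX x xX).
  have := subset_leq_card (subsetIr (conb G x :&: conb G v) (covered s :|: X)).
  have := leq_of_leqif (leq_card_setU (covered s) X); rewrite (card_covered ms) cX.
  have := n18; lia.
rewrite set0U => ginj.
have gP x : x \in X -> [/\ compl_adj G x (g x), g x \in conb G v,
    g x \notin unzip1 s ++ unzip2 s & g x \notin X].
  move=> /gF; rewrite !in_setD in_setU in_setI !inE negb_or.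
  by move=> /andP[/andP[-> ->] /andP[-> ->]].
have uX : uniq (enum X) := enum_uniq _.
have memX : {subset enum X <= X} by move=> x; rewrite mem_enum.
suff [s' ms' ss'] : exists2 s', comatching G (conb G v) s' & size s' = k.+1.
  by have := ff ms'; rewrite ss' ltnn.
pose ext l := [seq (x, g x) | x <- l] ++ s.
exists (ext (enum X)); last by rewrite size_cat size_map -cardE cX; lia.
elim: (enum X) uX memX => [|x l IH] //= /andP[xl ul] sub.
have xX : x \in X by apply: sub; rewrite inE eqxx.
have lX : {subset l <= X} by move=> y yl; apply: sub; rewrite inE yl orbT.
have [gx gA gs gX] := gP x xX.
have notin z : (z \in unzip1 (ext l) ++ unzip2 (ext l)) =
    [|| z \in l, z \in [seq g y | y <- l] | z \in unzip1 s ++ unzip2 s].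
  rewrite /ext /unzip1 /unzip2 !map_cat -!map_comp !mem_cat map_id.
  by case: (z \in l); case: (z \in map g l); case: (z \in map fst s); rewrite ?orbT.
rewrite comatching_cons gx gA IH // !notin !negb_or xl gs (Xs _ xX) /=.
have := subsetP XX x xX; rewrite inE => /andP[-> _] /=.
rewrite !andbT; apply/and3P; split.
- by apply/negP => /mapP[y yl e]; have [_ _ _] := gP y (lX _ yl); rewrite -e xX.
- by apply: contra gX; apply: lX.
- apply/negP => /mapP[y yl e]; move: xl.
  by rewrite (ginj x y) ?yl // lX.
Qed.

Lemma misplaced_le v : #|misplaced v| <= k.
Proof. by have := @well_placed_nu v [::] isT. Qed.

Definition isolated v : {set V} :=
  [set x in well_placed v | conb G x :&: well_placed v == set0].

(** Let [U] be left uncovered by a maximum matching [s] of the well-placed vertices, and let [j] be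
    the number of misplaced ones. Each edge of [s] spoils fewer than [k] vertices of [U], so at
    least [n - j - (k + 1) * size s] vertices are isolated. As [size s + j <= k], the bound
    [k * k + k + 1 <= n] makes this exceed [k * j]. *)
Lemma card_isolated v : k * #|misplaced v| < #|isolated v|.
Proof.
have [s ms smax] := max_comatching G (well_placed v).
pose A := conb G v; pose A0 := well_placed v; pose U := A0 :\: covered s.
have nu := well_placed_nu ms; set j := #|misplaced v| in nu *.
have cU : #|U| + (size s).*2 = #|A0| := card_uncovered ms.
have cA0 : #|A0| + j = #|A|.
  rewrite /A0 /well_placed cardsD (setIidPr _); last first.
    by apply/subsetP => x; rewrite inE => /andP[].
  rewrite subnK //; apply/subset_leq_card/subsetP => x; by rewrite inE => /andP[].
have cA := codegree_ge v; rewrite -/A in cA.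
(* The non-neighbours of [x] in [A] are misplaced or covered, at most [2 * k] in all. So [x] has at
   least [n - 2 * k - 1] neighbours in [A], and the degree bound leaves fewer than [2 * k]
   outside. *)
have lowA x : x \in A -> (x \in U \/ conb G x :&: U = set0) ->
    #|conb G x :&: A| <= 2 * k /\ #|nb G x :\: A| < 2 * k.
  move=> xA xU.
  have U0 : conb G x :&: U = set0.
    case: xU => // xU; apply/setP => y; rewrite !inE; apply/negP.
    move=> /andP[xy yU]; have := uncovered_clique ms smax xU.
    move: xy; rewrite /compl_adj => /andP[xy nxy].
    have yU' : y \in U by rewrite !inE; move: yU; rewrite -!andbA.
    by move=> /(_ y yU' xy); rewrite (negbTE nxy).
  have h : #|conb G x :&: A| <= 2 * k.
    apply: leq_trans (_ : #|misplaced v :|: covered s| <= _).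
      apply/subset_leq_card/subsetP => y /setIP[xy yA].
      have : y \notin conb G x :&: U by rewrite U0 inE.
      rewrite in_setI xy /= !in_setD yA in_setU andbT negb_and !negbK.
      by case/orP=> ->; rewrite ?orbT.
    have := leq_of_leqif (leq_card_setU (misplaced v) (covered s)).
    by rewrite (card_covered ms); lia.
  split=> //; have := card_nb_conb G A x; rewrite xA.
  by have := cardsID A (nb G x); have := small_degrees x; lia.
(* Being well placed, [x] has at least [3 * k] non-neighbours outside [A], and each vertex of [D] is
   adjacent to fewer than [2 * k] of them. *)
have fan x (D : {set V}) : x \in A0 -> D \subset conb G x :&: A ->
    {in D, forall d, d \in U \/ conb G d :&: U = set0} -> #|D| <= k.
  move=> xA0 DA hD.
  pose E := conb G x :\: A.
  have cE : 3 * k <= #|E|.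
    by move: xA0; rewrite 3!inE negb_and -leqNgt => /andP[+ xA]; rewrite xA.
  apply: (@fanfree_bipartite V G k x D E) => //.
  - exact: subset_trans DA (subsetIl _ _).
  - exact: subsetDl.
  - rewrite disjoints_subset; apply/subsetP => d /(subsetP DA).
    by rewrite !inE => /andP[_ ->].
  - move=> d dD; have /setIP[dx dA] := subsetP DA d dD.
    have [_ low] := lowA d dA (hD d dD).
    have := card_nb_conb G E d.
    have : #|nb G d :&: E| <= #|nb G d :\: A|.
      by apply/subset_leq_card/subsetP => y; rewrite !inE => /and3P[-> ->].
    have -> : d \in E = false by rewrite /E inE dA.
    by lia.
pose c (p : V * V) := (conb G p.1 :|: conb G p.2) :&: U.
have cs p : p \in s -> #|c p| < k.
  case: p => a b ps; have /andP[_ /allP/(_ _ ps)/and3P[/= aA bA ab]] := ms.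
  have A0A x : x \in A0 -> x \in A by rewrite inE => /andP[].
  (* For an edge of [s] with only one end non-adjacent to vertices of [U]: adding the other end to
     [D] makes the inequality strict. If both ends are, [augment] leaves a single vertex of [U]. *)
  have one (x y : V) : x \in A0 -> y \in A -> y \notin U -> y \in conb G x ->
      conb G y :&: U = set0 -> #|conb G x :&: U| < k.
    move=> xA yA yU xy y0; have := fan x (y |: (conb G x :&: U)) xA.
    rewrite cardsU1 in_setI (negbTE yU) andbF add1n; apply.
      rewrite subUset sub1set in_setI xy yA setIS //.
      by apply/subsetP => z; rewrite inE => /andP[_ /A0A].
    by move=> d /setU1P[->|/setIP[_ ?]]; [right|left].
  have cov x : x \in unzip1 s ++ unzip2 s -> x \notin U.
    by move=> xs; rewrite !inE xs.
  have aU : a \notin U.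
    by apply: cov; rewrite mem_cat; apply/orP; left; apply/mapP; exists (a, b).
  have bU : b \notin U.
    by apply: cov; rewrite mem_cat; apply/orP; right; apply/mapP; exists (a, b).
  have abc : b \in conb G a by rewrite inE.
  rewrite /c setIUl /=.
  have [b0|[u' bu']] := set_0Vmem (conb G b :&: U).
    by rewrite b0 setU0; apply: (one a b) => //; apply: A0A.
  have [a0|[u au]] := set_0Vmem (conb G a :&: U).
    by rewrite a0 set0U; apply: (one b a) => //; [apply: A0A | rewrite conb_sym].
  have aug w w' : w \in conb G a :&: U -> w' \in conb G b :&: U -> w = w'.
    case/setIP=> aw wU /setIP[bw wU'].
    by apply: (augment ms smax ps wU wU') => /=; rewrite -in_set.
  apply: leq_ltn_trans (_ : #|[set u]| < k); last by rewrite cards1; lia.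
  apply: subset_leq_card; apply/subsetP => w; rewrite in_setU => /orP[aw|bw]; rewrite in_set1.
    by rewrite (aug _ _ aw bu') (aug _ _ au bu').
  by rewrite (aug _ _ au bw).
pose C := \bigcup_(p in [set p in s]) c p.
have cC : #|C| <= size s * k.-1.
  apply: leq_trans (card_bigcup_le _ _) _.
  apply: leq_trans (_ : \sum_(p in [set p in s]) k.-1 <= _).
    by apply: leq_sum => p; rewrite inE => /cs; lia.
  by rewrite sum_nat_const leq_mul2r cardsE card_size orbT.
have sub : U :\: C \subset isolated v.
  apply/subsetP => u /setDP[uU uC]; have /setDP[uA0 us] := uU.
  rewrite inE uA0 /=; apply/eqP/setP => y; rewrite inE [RHS]inE.
  apply/negP => /andP[uy yA0].
  have [ys|ys] := boolP (y \in covered s); last first.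
    have yU : y \in U by rewrite in_setD ys.
    move: uy; rewrite in_conb => /andP[uy]; apply/negP; rewrite negbK.
    exact: (uncovered_clique ms smax).
  have [p ps yp] : exists2 p, p \in s & (y == p.1) || (y == p.2).
    move: ys; rewrite inE mem_cat => /orP[] /mapP[p ps ->]; exists p; rewrite ?eqxx ?orbT //.
  case/negP: uC; apply/bigcupP; exists p; first by rewrite inE.
  rewrite /c in_setI uU andbT in_setU -!(conb_sym G u).
  by case/orP: yp => /eqP <-; rewrite uy ?orbT.
have := subset_leq_card sub; rewrite cardsD.
have := subset_leq_card (subsetIr U C).
move: #|U :&: C| #|C| #|isolated v| cC cU cA0 cA nu nk k17.
move: #|U| #|A0| #|A| (size s) j => a b d r l e f g *; nia.
Qed.

(* For [v] with fewest misplaced vertices and [u] isolated, each isolated vertex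
   is co-adjacent to one of the misplaced vertices for [u], but each of these is
   co-adjacent to at most [k] isolated vertices. *)
Lemma no_small_degrees : False.
Proof.
have /card_gt0P[v0 _] : 0 < #|V| by have := n18; lia.
case: (@arg_minnP V v0 xpredT (fun v => #|misplaced v|) isT) => v _ vmin.
set j := #|misplaced v| in vmin; pose W := isolated v.
have cW : k * j < #|W| := card_isolated v.
have jk : j <= k := misplaced_le v.
pose A := conb G v; pose A0 := well_placed v; pose B0 := ~: A0.
have cA := codegree_ge v.
have cA0 : #|A0| + j = #|A|.
  rewrite /A0 /well_placed cardsD (setIidPr _); last first.
    by apply/subsetP => x; rewrite inE => /andP[].
  rewrite subnK //; apply/subset_leq_card/subsetP => x; by rewrite inE => /andP[].
have WP w : w \in W -> w \in A0 /\ conb G w \subset B0.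
  rewrite inE => /andP[-> /eqP e]; split=> //.
  by rewrite -disjoints_subset -setI_eq0 e.
(* The non-neighbours of [w], at least [n] in number, all lie in [B0], which has at most [n - 1 + j]
   elements. *)
have Wnb w : w \in W -> #|nb G w :&: B0| < j.
  move=> /WP[wA0 wB]; have := card_nb_conb G B0 w.
  rewrite (setIidPl wB) in_setC wA0 /= addn0.
  have := codegree_ge w; have := cardsC A0; rewrite -/B0.
  by move: cA; rewrite -/A; lia.
have /card_gt0P[u uW] : 0 < #|W| by lia.
(* By minimality [u] has [j] misplaced vertices, too many for a [w] in [W] to be adjacent to all of
   them. *)
have [X Xm cX] := subset_of_card (vmin u isT).
have [uA0 uB] := WP u uW.
have XB x : x \in X -> x \in B0.
  by move=> /(subsetP Xm); rewrite inE => /andP[/(subsetP uB)].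
have cXW x : x \in X -> #|conb G x :&: W| <= k.
  move=> xX; have := subsetP Xm x xX; rewrite inE => /andP[_ hx].
  pose E := conb G x :&: B0.
  have cE : n < #|E| + 3 * k.
    have := cardsID B0 (conb G x); have := codegree_ge x; rewrite -/E.
    have : #|conb G x :\: B0| <= #|conb G x :\: conb G u|.
      apply/subset_leq_card/setDS/(subset_trans _ (subxx _)); exact: uB.
    lia.
  apply: (@fanfree_bipartite V G k x _ E) => //.
  - exact: subsetIl.
  - exact: subsetIl.
  - rewrite disjoints_subset; apply/subsetP => d /setIP[_ /WP[dA _]].
    by rewrite in_setC in_setI negb_and in_setC dA orbT.
  - move=> d /setIP[_ dW]; have [dA0 _] := WP d dW.
    have := card_nb_conb G E d; have := Wnb d dW.
    have -> : d \in E = false by rewrite in_setI in_setC dA0 andbF.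
    have : #|nb G d :&: E| <= #|nb G d :&: B0|.
      by apply/subset_leq_card/setIS/subsetIr.
    have := n18; lia.
have sub : W \subset \bigcup_(x in X) (conb G x :&: W).
  apply/subsetP => w wW; have [wA0 wB] := WP w wW.
  have : ~~ (X \subset nb G w :&: B0).
    by apply/negP => /subset_leq_card; rewrite cX leqNgt (Wnb w wW).
  case/subsetPn=> x xX; rewrite in_setI (XB x xX) andbT in_nb => wx.
  apply/bigcupP; exists x => //; rewrite in_setI wW andbT -conb_sym in_conb wx andbT.
  by apply: contraTneq (XB x xX) => <-; rewrite in_setC wA0.
have := leq_trans (subset_leq_card sub) (card_bigcup_le _ _).
have : \sum_(x in X) #|conb G x :&: W| <= \sum_(x in X) k.
  by apply: leq_sum => x; apply: cXW.
rewrite sum_nat_const cX; lia.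
Qed.

End LargeDegree.

Lemma large_degree (V : finType) (G : sgraph V) k n : fanfree G k ->
  #|V| + 1 = 2 * n -> 17 <= k -> k * k + k + 1 <= n ->
  exists x, n <= #|nb G x| + 1.
Proof.
move=> ff cV k17 nk.
case: (pickP (fun x => n <= #|nb G x| + 1)) => [x hx|h]; first by exists x.
by case: (no_small_degrees ff cV k17 nk) => x; have := h x; lia.
Qed.

(** * Embedding a unicyclic graph *)

Lemma pick_outside (V : finType) (A B : {set V}) : #|B| < #|A| ->
  exists2 v, v \in A & v \notin B.
Proof.
move=> BA; apply/subsetPn; apply/negP => /subset_leq_card.
by rewrite leqNgt BA.
Qed.

(** The image [g y] is no neighbour of itself, so at most [#|S| - 1] of its neighbours are used. *)
Lemma unused_nb (T V : finType) (G : sgraph V) (S : {set T}) (g : T -> V) y :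
  y \in S -> #|S| <= #|nb G (g y)| -> exists2 v, v \in nb G (g y) & v \notin g @: S.
Proof.
move=> yS hS; apply/subsetPn; apply/negP => sub.
have : nb G (g y) \subset (g @: S) :\ g y.
  apply/subsetP => v vN; rewrite in_setD1 (subsetP sub v vN) andbT.
  by apply: contraTneq vN => ->; rewrite nb_irr.
move/subset_leq_card; have : #|g @: S| <= #|S| by apply: leq_imset_card.
by rewrite (cardsD1 (g y)) imset_f //; lia.
Qed.

Section PeelSlots.
Variables (T : finType) (H : sgraph T).
(* Removing [j] pendant vertices one after the other destroys at most [j] of the
   slots: the neighbour of a removed vertex lies in at most one [x |: nb H x]. *)
Lemma peel_slots (C B I : {set T}) j : grows H C B -> #|C| + j <= #|B| ->
  {in I, forall x z, z \in x |: nb H x -> z \in B /\ nb H z \subset B} ->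
  {in I &, forall x y, x != y -> [disjoint x |: nb H x & y |: nb H y]} ->
  exists S I' : {set T}, [/\ grows H S B, #|S| + j = #|B|, I' \subset I,
    #|I| <= #|I'| + j &
    {in I', forall x z, z \in x |: nb H x -> z \in S /\ nb H z \subset S}].
Proof.
elim: j B I => [|j IH] B I CB cj prot disj.
  by exists B, I; rewrite !addn0; split=> //; apply: grows_refl.
case: CB cj prot => [|B' x y CB' xB' nx] cj prot; first by lia.
have cB : #|x |: B'| = #|B'|.+1 by rewrite cardsU1 xB'.
have yx z : z \in B' -> adj H x z -> z = y.
  move=> zB xz; have : z \in nb H x :&: B' by rewrite in_setI zB in_nb xz.
  by rewrite nx inE => /eqP.
have nb_x (z : T) : z \in x |: B' -> adj H z x -> z = y.
  move=> /setU1P[->|zB]; first by rewrite adj_irrefl.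
  by rewrite adj_sym; apply: yx.
pose I1 := [set i in I | y \notin i |: nb H i].
have cI : #|I| <= #|I1| + 1.
  have [e|[i /setDP[iI iN]]] := set_0Vmem (I :\: I1).
    by rewrite -(cardsID I1 I) e cards0 leq_add // subset_leq_card ?subsetIr.
  rewrite -(cardsID I1 I) leq_add ?subset_leq_card ?subsetIr //.
  rewrite -(cards1 i); apply/subset_leq_card/subsetP => i' /setDP[i'I i'N].
  rewrite inE; apply/negPn/negP => ne; have := disj i' i i'I iI ne.
  move: iN i'N; rewrite !inE iI i'I /= !negbK -!in_nb -!in_setU1 => y1 y2.
  by move=> /disjointFr/(_ y2); rewrite y1.
have prot1 : {in I1, forall i z, z \in i |: nb H i -> z \in B' /\ nb H z \subset B'}.
  move=> i; rewrite inE => /andP[iI yi] z zi.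
  have [zB nzB] := prot i iI z zi.
  have [iB _] := prot i iI i (setU11 _ _).
  have xi : x \notin i |: nb H i.
    apply: contra yi => /setU1P[xi|]; last first.
      by rewrite in_nb => /(nb_x _ iB) ->; rewrite setU11.
    have : y \in nb H x :&: B' by rewrite nx inE.
    by rewrite -xi => /setIP[xy _]; rewrite in_setU1 xy orbT.
  have zB' : z \in B'.
    by case/setU1P: zB => // zx; rewrite zx (negbTE xi) in zi.
  split=> //; apply/subsetP => w wz; have /setU1P[wx|//] := subsetP nzB w wz.
  have e : z = y by apply: nb_x zB _; rewrite -wx -in_nb.
  by rewrite -e zi in yi.
have cj' : #|C| + j <= #|B'| by lia.
have [|S [I' [gS cS I'I cI' prot']]] := IH B' I1 CB' cj' prot1.
  by move=> a b; rewrite !inE => /andP[aI _] /andP[bI _]; apply: disj.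
exists S, I'; split=> //; last by lia.
- exact: grows_step gS xB' nx.
- by lia.
- by apply: subset_trans I'I _; apply/subsetP => i; rewrite inE => /andP[].
Qed.
End PeelSlots.

(** * Cycles through a clique and a second set *)

Section Paths.
Variables (V : finType) (G : sgraph V).

Lemma is_cycle_seq x0 w : 0 < size w -> uniq w -> cycle (adj G) w ->
  is_cycle G (size w) (nth x0 w).
Proof.
case: w => // a w _ uw cw; split.
- by move=> i j hi hj /eqP; rewrite nth_uniq // => /eqP.
- move=> i hi; move: cw; rewrite /= rcons_path => /andP[pw _].
  exact: (pathP x0 pw).
- move: cw; rewrite /= rcons_path => /andP[_].
  by rewrite -[last a w]/(last x0 (a :: w)) -nth_last.
Qed.

Lemma clique_path (U : {set V}) x s : clique G U -> x \in U -> {subset s <= U} ->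
  uniq (x :: s) -> path (adj G) x s.
Proof.
move=> clU; elim: s x => //= y s IH x xU sU /and3P[xs ys us].
have yU : y \in U by apply: sU; rewrite inE eqxx.
rewrite clU // ?IH ?ys //=; first by move=> z zs; apply: sU; rewrite inE zs orbT.
by apply: contraNneq xs => ->; rewrite inE eqxx.
Qed.

Lemma path_with_ends (P : {set V}) x y r : 1 < r -> x \in P -> y \in P -> x != y ->
  {in P &, forall u v, r < #|nb G u :&: nb G v :&: P|} ->
  exists s, [/\ size s = r, path (adj G) x s, last x s = y, uniq (x :: s)
    & {subset s <= P}].
Proof.
move=> r1 xP yP xy common.
have step j : j < r -> exists s, [/\ size s = j, path (adj G) x s,
    uniq (x :: s), {subset s <= P} & y \notin x :: s].
  elim: j => [|j IH] jr; first by exists [::]; rewrite inE eq_sym.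
  have [s [ss ps us sP ys]] := IH (ltnW jr).
  have lP : last x s \in P.
    by have := mem_last x s; rewrite inE => /orP[/eqP ->|/sP].
  have [|v] := @pick_outside _ (nb G (last x s) :&: P) (y |: [set z in x :: s]).
    rewrite cardsU1 inE ys cardsE (card_uniqP us) /= ss.
    by have := common _ _ lP lP; rewrite setIid; clear -jr; lia.
  rewrite in_setI in_nb => /andP[lv vP]; rewrite in_setU1 inE negb_or => /andP[vy vs].
  exists (rcons s v); split.
  - by rewrite size_rcons ss.
  - by rewrite rcons_path ps lv.
  - by rewrite -rcons_cons rcons_uniq vs us.
  - by move=> z; rewrite mem_rcons inE => /orP[/eqP ->|/sP].
  - by rewrite -rcons_cons mem_rcons inE negb_or eq_sym vy.
have [s [ss ps us sP ys]] := step (r - 2) ltac:(clear -r1; lia).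
have lP : last x s \in P.
  by have := mem_last x s; rewrite inE => /orP[/eqP ->|/sP].
have [|w] := @pick_outside _ (nb G (last x s) :&: nb G y :&: P) [set z in x :: s].
  by rewrite cardsE (card_uniqP us) /= ss; have := common _ _ lP yP; clear -r1; lia.
rewrite !in_setI !in_nb inE => /andP[/andP[lw yw] wP] ws.
exists (rcons (rcons s w) y); split.
- by rewrite !size_rcons ss; clear -r1; lia.
- by rewrite !rcons_path last_rcons ps lw adj_sym.
- by rewrite last_rcons.
- by rewrite -!rcons_cons !rcons_uniq mem_rcons in_cons negb_or (adj_neq yw) ys ws us.
- move=> z; rewrite !mem_rcons in_cons mem_rcons in_cons => /or3P[/eqP ->|/eqP ->|/sP] //.
Qed.

(** The cycle runs through [P] from [b1] to [b2], crosses to [a2], takes further vertices of the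
    clique as needed and returns by [a1]. *)
Lemma mixed_cycle (U P : {set V}) a1 b1 a2 b2 r c :
  clique G U -> [disjoint P & U] ->
  a1 \in U -> a2 \in U -> a1 != a2 -> b1 \in P -> b2 \in P -> b1 != b2 ->
  adj G a1 b1 -> adj G a2 b2 ->
  {in P &, forall u v, r < #|nb G u :&: nb G v :&: P|} ->
  2 < r -> r + 2 <= c <= r + #|U| -> 1 < #|U| ->
  exists w, [/\ size w = c, is_cycle G c (nth a1 w),
    forall i, i < r -> nth a1 w i \in P & forall i, r <= i < c -> nth a1 w i \in U].
Proof.
move=> clU PU a1U a2U a12 b1P b2P b12 ab1 ab2 common r2 hc U1.
have [|||||q [sq pq lq uq qP]] := @path_with_ends P b1 b2 r.-1 => //.
- by clear -r2; lia.
- by move=> u v uP vP; apply: leq_ltn_trans (leq_pred r) (common u v uP vP).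
pose X0 := U :\: [set a1; a2].
have cX0 : #|X0| + 2 = #|U|.
  rewrite /X0 cardsD (setIidPr _) ?cards2 ?a12; last by rewrite subUset !sub1set a1U a2U.
  by rewrite subnK.
have [X XX cX] := @subset_of_card _ X0 (c - r - 2) ltac:(clear -cX0 hc; lia).
have Xnot x : x \in X -> [/\ x \in U, x != a1 & x != a2].
  by move=> /(subsetP XX); rewrite in_setD !inE negb_or => /andP[/andP[-> ->] ->].
pose tl := a2 :: rcons (enum X) a1.
have tailU : {subset tl <= U}.
  move=> x; rewrite in_cons mem_rcons in_cons mem_enum.
  by move=> /or3P[/eqP ->|/eqP ->|/Xnot[]].
have headP : {subset b1 :: q <= P}.
  by move=> x; rewrite in_cons => /orP[/eqP ->|/qP].
have utail : uniq tl.
  rewrite /= rcons_uniq enum_uniq andbT mem_rcons in_cons !mem_enum negb_or eq_sym a12 /=.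
  by apply/andP; split; apply/negP => /Xnot[]; rewrite eqxx.
have stl : size tl = c - r by rewrite /= size_rcons -cardE cX; clear -hc; lia.
have shd : size (b1 :: q) = r by rewrite /= sq prednK //; clear -r2; lia.
pose w := (b1 :: q) ++ tl.
have sw : size w = c by rewrite size_cat stl shd; clear -hc; lia.
have uw : uniq w.
  rewrite /w cat_uniq uq utail andbT andTb.
  by apply/hasPn => x /tailU xU; apply/negP => /headP/(disjointFr PU); rewrite xU.
have cw : cycle (adj G) w.
  rewrite /w /tl /= rcons_cat cat_path pq lq rcons_cons /= adj_sym ab2 /=.
  rewrite rcons_path last_rcons ab1 andbT.
  apply: (clique_path clU) => //.
  by move=> x xs; apply: tailU; rewrite in_cons xs orbT.
exists w; split=> //.
- by rewrite -sw; apply: is_cycle_seq => //; rewrite sw; clear -hc r2; lia.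
- by move=> i ir; rewrite /w nth_cat shd ir; apply/headP/mem_nth; rewrite shd.
- move=> i /andP[ri ic]; rewrite /w nth_cat shd ltnNge ri /=.
  by apply/tailU/mem_nth; rewrite stl; clear -ri ic; lia.
Qed.

(* An arc of [r] vertices of the cycle is routed through [P], the rest through
   [U]. *)
Lemma embed_across (T : finType) (H : sgraph T) (U P : {set V}) a1 b1 a2 b2 r
    x0 (C : {set T}) (s : seq T) :
  clique G U -> [disjoint P & U] ->
  a1 \in U -> a2 \in U -> a1 != a2 -> b1 \in P -> b2 \in P -> b1 != b2 ->
  adj G a1 b1 -> adj G a2 b2 ->
  {in P &, forall u v, r < #|nb G u :&: nb G v :&: P|} ->
  {in P, forall u, 2 * r <= #|nb G u :&: P|} ->
  2 < r -> r + 2 <= #|U| -> #|U| + r = #|T| ->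
  grows H C setT -> #|T| < #|C| + r -> uniq s -> s =i C ->
  (forall i j, i < size s -> j < size s -> adj H (nth x0 s i) (nth x0 s j) ->
      j = i.+1 %% size s \/ i = j.+1 %% size s) ->
  subgraph_of H G.
Proof.
move=> clU PU a1U a2U a12 b1P b2P b12 ab1 ab2 common degP r2 rU cT gC gC' us sC hs.
have cs : size s = #|C| by rewrite -(card_uniqP us); apply: eq_card.
have cCn : #|C| <= #|T| by apply: max_card.
have [w [_ hw wP wU]] := @mixed_cycle U P a1 b1 a2 b2 r (size s) clU PU a1U a2U a12
  b1P b2P b12 ab1 ab2 common r2 ltac:(clear -cs cCn gC' rU cT; lia) ltac:(clear -r2 rU; lia).
have s1 : 1 < size s by clear -cs gC' rU cT; lia.
have e0 := cycle_embedding sC s1 hs hw; set f := (fun z => _) in e0.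
pose CP := [set z in C | index z s < r].
have fP z : z \in CP -> f z \in P by rewrite inE => /andP[_ hz]; apply: wP.
have fU z : z \in C -> z \notin CP -> f z \in U.
  move=> zC; rewrite inE zC /= -leqNgt => hz.
  by apply: wU; rewrite hz index_mem sC.
have cCP : #|CP| = r.
  have -> : CP = [set z in take r s].
    apply/setP => z; rewrite !inE -sC; apply/andP/idP => [[zs hz]|zt].
      by rewrite in_take.
    have zs := mem_take zt; split=> //; by rewrite -in_take.
  rewrite cardsE (card_uniqP (take_uniq _ us)) size_takel //; clear -cs gC' rU cT; lia.
have CPC : CP \subset C by apply/subsetP => z; rewrite inE => /andP[].
have PnU z : z \in P -> z \notin U by move=> /(disjointFr PU) ->.
have [|g [eg _ _]] := grow_embed (good := fun=> U :|: P) gC e0.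
  move=> S g x y CS _ _ gf gg _ xS yS xy _.
  have Sn : #|S| < #|T|.
    rewrite -[#|T|]cardsT; apply: proper_card; apply/properP; split; first exact: subsetT.
    by exists x.
  have gCP z : z \in CP -> g z \in P.
    by move=> zP; rewrite gf ?fP // (subsetP CPC).
  have gCU z : z \in C -> z \notin CP -> g z \in U by move=> zC zP; rewrite gf ?fU.
  have usedU : g @: S :&: U \subset g @: (S :\: CP).
    apply/subsetP => v /setIP[/imsetP[z zS ->] zU]; apply: imset_f.
    by rewrite in_setD zS andbT; apply/negP => /gCP/PnU; rewrite zU.
  have usedP : g @: S :&: P \subset g @: (S :\: (C :\: CP)).
    apply/subsetP => v /setIP[/imsetP[z zS ->] zP]; apply: imset_f.
    rewrite in_setD zS andbT; apply/negP => /setDP[zC zN].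
    by have := PnU _ zP; rewrite gCU.
  (* The arc [CP] avoids [U] and the rest of the cycle avoids [P], so fewer than [#|U|] vertices of
     [U] and fewer than [2 * r] of [P] are in use. *)
  have cSU : #|g @: S :&: U| + r < #|T|.
    have h1 := leq_trans (subset_leq_card usedU) (leq_imset_card _ _).
    have := cardsID CP S; rewrite (setIidPr (subset_trans CPC CS)) cCP.
    by clear -h1 Sn; lia.
  have cSP : #|g @: S :&: P| + #|C| < #|T| + r.
    have h1 := leq_trans (subset_leq_card usedP) (leq_imset_card _ _).
    have := cardsID (C :\: CP) S.
    rewrite (setIidPr (subset_trans (subsetDl _ _) CS)).
    have := cardsID CP C; rewrite (setIidPr CPC) cCP.
    by clear -h1 Sn; lia.
  have gy : g y \in U :|: P.
    have [yC|yC] := boolP (y \in C); last by apply: gg; rewrite in_setD yC.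
    rewrite in_setU; have [/gCP ->|/(gCU _ yC) ->//] := boolP (y \in CP).
    by rewrite orbT.
  case/setUP: gy => gy.
    have [|v vU vN] := @pick_outside _ U (g @: S :&: U).
      by clear -cSU cT; lia.
    have {}vN : v \notin g @: S by apply: contra vN => vg; rewrite in_setI vg.
    exists v => //; rewrite in_setI in_setU vU in_nb clU //.
    by apply: contraNneq vN => <-; apply: imset_f.
  have [|v vy vN] := @pick_outside _ (nb G (g y) :&: P) (g @: S :&: P).
    by have := degP _ gy; clear -cSP gC'; lia.
  have [vyn vP] := setIP vy.
  exists v; first by rewrite in_setI vyn in_setU vP orbT.
  by apply: contra vN => vg; rewrite in_setI vg.
exact: embedsT eg.
Qed.

End Paths.

Section Spread.
Variables (T : finType) (H : sgraph T).

Definition spread (I : {set T}) := {in I, forall x, #|nb H x| <= 2} /\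
  {in I &, forall x y, x != y -> [disjoint x |: nb H x & y |: nb H y]}.

Lemma spread_indep I : spread I -> {in I &, forall x y, ~~ adj H x y}.
Proof.
move=> [_ disI] x y xI yI; have [->|xy] := eqVneq x y; first by rewrite adj_irrefl.
apply/negP => axy; have := disjointFr (disI _ _ xI yI xy) (setU11 x _).
by rewrite in_setU1 in_nb adj_sym axy orbT.
Qed.

Lemma spread_one I y : spread I -> #|nb H y :&: I| <= 1.
Proof.
move=> [_ disI].
apply/card_le1P => x /setIP[yx xI] z; rewrite [RHS]inE; apply/setIP/eqP => [[yz zI]|-> //].
apply/eqP/negPn/negP => zx.
have yz' : y \in z |: nb H z by rewrite in_setU1 nb_sym yz orbT.
have := disjointFr (disI _ _ zI xI zx) yz'.
by rewrite in_setU1 nb_sym yx orbT.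
Qed.
End Spread.

Section Leaves.
Variables (T : finType) (H : sgraph T).
Hypothesis uH : unicyclic_on H setT.

Lemma remove_leaves (Q : {set T}) : Q \subset leaves H ->
  unicyclic_on H (~: Q) /\ grows H (~: Q) setT.
Proof.
have [r] := ubnP #|Q|; elim: r Q => // r IH Q cQ QL.
have [->|[q qQ]] := set_0Vmem Q; first by rewrite setC0; split=> //; apply: grows_refl.
have [||u g] := IH (Q :\ q).
- by move: cQ; rewrite (cardsD1 q) qQ.
- by apply: subset_trans QL; apply: subsetDl.
have E : ~: Q = ~: (Q :\ q) :\ q.
  by apply/setP => z; rewrite !inE negb_and negbK; case: eqP => // ->; rewrite qQ.
have [||u' g'] := unicyclic_on_remove (x := q) u.
- by rewrite !inE eqxx.
- by apply: leq_trans (deg_in_le _ _ _) _; have := subsetP QL q qQ; rewrite inE => /eqP ->.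
by rewrite E; split=> //; apply: grows_trans g' g.
Qed.
End Leaves.

(** * The case distinction *)

Section Host.
Variables (T V : finType) (H : sgraph T) (G : sgraph V) (k n : nat).
Hypothesis uH : unicyclic_on H setT.
Hypothesis cT : #|T| = n.
Hypothesis ff : fanfree G k.
Hypothesis cV : #|V| + 1 = 2 * n.
Hypothesis k17 : 17 <= k.
Hypothesis nk : k * k + k + 1 <= n.

Let n18 : 18 * k <= n := quadratic_ge k17 nk.

Lemma T_gt1 : 1 < #|T|.
Proof. by rewrite cT; have := n18; lia. Qed.

Lemma V_gt0 : 0 < #|V|.
Proof. by have := n18; lia. Qed.

Lemma large_min_degree : (forall x, n <= #|nb G x|) -> subgraph_of H G.
Proof.
move=> hd; have /card_gt0P[x0 _] := ltnW T_gt1.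
have [C [_ gC uC dC]] := peel uH (sub0set _).
have [|s [us sC s3 hs]] := cyclic_order x0 uC; first by move=> x xC; apply: dC; rewrite ?inE.
have cs : size s <= n.
  by rewrite -(card_uniqP us) -cT; apply: max_card.
have [||u hu] := @pancyclic V G (size s); first by move=> x; have := hd x; lia.
  by rewrite s3; apply: leq_trans cs _; have := n18; lia.
have eC := cycle_embedding sC (ltnW s3) hs hu.
have [|g [eg _ _]] := grow_embed (good := fun=> setT) gC eC.
  move=> S g x y _ _ _ _ _ _ xS yS _ _.
  have [|v vy vS] := @unused_nb T V G S g y yS.
    by apply: leq_trans (hd _); rewrite -cT; apply: max_card.
  by exists v; rewrite // setIT.
exact: embedsT eg.
Qed.

Lemma low_independent r : r <= k -> exists I : {set T},
  [/\ #|I| = r, {in I, forall x, #|nb H x| <= 2}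
    & {in I &, forall x y, ~~ adj H x y}].
Proof.
move=> rk; have [p hp|hM] := pickP (fun p => k <= nleaves H p).
  have [I IL cI] := @subset_of_card _ (nb H p :&: leaves H) r (leq_trans rk hp).
  have Il x : x \in I -> x \in leaves H by move=> /(subsetP IL)/setIP[].
  exists I; split=> //.
    by move=> x /Il; rewrite inE => /eqP ->.
  by move=> x y /Il xl /Il yl; apply: (leaf_indep uH T_gt1 xl yl).
have [||I [cI dI iI _]] := @slots3 T H uH T_gt1 k k17; first by rewrite cT.
  by move=> x; have := hM x; lia.
have [|I' II cI'] := @subset_of_card _ I r; first lia.
exists I'; split=> //; first by move=> x /(subsetP II)/dI.
by move=> x y /(subsetP II) xI /(subsetP II) yI; apply: iI.
Qed.

Lemma slot_finish (U Z0 : {set V}) (I : {set T}) c e :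
  clique G U -> [disjoint Z0 & U] -> n <= #|U| + #|Z0| -> #|U| <= n ->
  n <= #|U| + #|I| ->
  {in I, forall x, #|nb H x| <= 2} -> {in I &, forall x y, ~~ adj H x y} ->
  (forall y, #|nb H y :&: I| <= c) ->
  {in Z0, forall z, #|conb G z :&: U| <= e} ->
  c * e + (n - #|U|).*2 <= #|U| -> subgraph_of H G.
Proof.
move=> cU ZU cUZ Un UI d2 iI hc he hn.
have [Z ZZ cZ] := @subset_of_card _ Z0 (n - #|U|) ltac:(lia).
have [I' II cI] := @subset_of_card _ I (n - #|U|) ltac:(lia).
have /card_gt0P[v0 _] := V_gt0.
have Isub x : x \in I' -> x \in I by apply: (subsetP II).
have [||||||||||||||f [ef _ _ _]] :=
  @slot_embedding T V H G v0 U Z setT I' set0 set0 c e cU.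
- exact: disjointWl ZZ ZU.
- exact: sub0set.
- exact: subsetT.
- by move=> x _; apply: subsetT.
- by move=> x y /Isub xI /Isub; apply: iI.
- by move=> x /Isub/d2.
- by move=> y; apply: leq_trans (hc y); apply/subset_leq_card/setIS.
- exact: sub0set.
- by move=> x _; rewrite disjoint_sym -setI_eq0 set0I.
- by rewrite !cards0.
- by rewrite cI cZ.
- by rewrite cardsT cT cZ; lia.
- by move=> z /(subsetP ZZ)/he.
- by rewrite cI cards0 addn0.
exact: embedsT ef.
Qed.

Lemma uniq_ends A s (sel : V * V -> V) : comatching G A s ->
  (forall p, sel p = p.1 \/ sel p = p.2) ->
  uniq (map sel s) /\ {subset map sel s <= unzip1 s ++ unzip2 s}.
Proof.
move=> + hsel; elim: s => //= -[a b] s IH.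
rewrite comatching_cons => /and5P[_ _ _ aN /andP[bN ms]].
have [us sub] := IH ms; split.
  rewrite us andbT; case: (hsel (a, b)) => ->.
    by apply: contra aN; apply: sub.
  by apply: contra bN; apply: sub.
move=> z; rewrite inE mem_ends_cons => /orP[/eqP ->|/sub ->]; last by rewrite !orbT.
by case: (hsel (a, b)) => ->; rewrite eqxx ?orbT.
Qed.

Lemma large_codegree v : n + k <= #|conb G v| -> subgraph_of H G.
Proof.
move=> hv; have [s ms smax] := max_comatching G (conb G v).
set A := conb G v in ms smax hv; pose U := A :\: covered s.
have cU := card_uncovered ms; have sk := ff ms.
rewrite -/U in cU.
(* By [augment] each edge of the maximum matching has an end with at most one non-neighbour in [U].
   Together with [U] these ends form a set of [#|A| - size s >= n] vertices. *)
pose sel (p : V * V) := if #|conb G p.1 :&: U| <= 1 then p.1 else p.2.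
have selP p : sel p = p.1 \/ sel p = p.2 by rewrite /sel; case: ifP; auto.
have [usel subsel] := uniq_ends ms selP.
have sel1 p : p \in s -> #|conb G (sel p) :&: U| <= 1.
  move=> ps; rewrite /sel; case: ifP => // /negbT h.
  have [->|[u' /setIP[u'p u'U]]] := set_0Vmem (conb G p.2 :&: U); first by rewrite cards0.
  case/negP: h; apply: leq_trans (_ : #|[set u']| <= 1); last by rewrite cards1.
  apply/subset_leq_card/subsetP => u /setIP[up uU]; rewrite inE; apply/eqP.
  by apply: (augment ms smax ps uU u'U); rewrite -in_set.
pose Y := [set y in map sel s].
have cY : #|Y| = size s by rewrite cardsE (card_uniqP usel) size_map.
have YU : [disjoint Y & U].
  rewrite disjoints_subset; apply/subsetP => y; rewrite inE => /subsel ys.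
  by rewrite !inE ys.
have clU : clique G U := uncovered_clique ms smax.
have [Un|Un] := leqP n #|U|.
  have [U' UU cU'] := subset_of_card Un.
  apply: (@slot_finish U' set0 set0 0 0); rewrite ?cards0 ?cU' ?addn0 //.
  - exact: cliqueS UU clU.
  - by rewrite -setI_eq0 set0I.
  - by move=> x; rewrite inE.
  - by move=> x y; rewrite inE.
  - by move=> y; rewrite setI0 cards0.
  - by move=> y; rewrite inE.
  - by rewrite subnn.
have [I [cI d2 iI]] := low_independent sk.
apply: (@slot_finish U Y I (size s) 1) => //.
- by rewrite cY; lia.
- exact: ltnW.
- by rewrite cI; lia.
- by move=> y; rewrite -cI; apply/subset_leq_card/subsetIr.
- by move=> z; rewrite inE => /mapP[p ps ->]; apply: sel1.
- by have := n18; lia.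
Qed.

(** * The middle range of the largest codegree *)

Section Core.
Variables (d : nat) (U : {set V}).
Hypothesis d_ge : n <= d + 1.
Hypothesis d_lt : d < n + k.
Hypothesis deg_ge : forall x, 2 * n <= #|nb G x| + d + 2.
Hypothesis clU : clique G U.
Hypothesis cU : #|U| + 2 * k = d.

(* "Low" refers to the degree in the complement. *)
Definition low : {set V} := [set a in U | n <= #|nb G a| + 1].

(** Apply [large_clique] to [conb G a], which has at least [n] vertices and misses [U] because [U]
    is a clique containing [a]. *)
Lemma second_clique a : a \in U -> #|nb G a| + 2 <= n ->
  exists U2 : {set V}, [/\ U2 \subset conb G a, clique G U2,
    #|U2| + 2 * k = n & [disjoint U2 & U]].
Proof.
move=> aU da; have [|U1 U1a [cl1 c1]] := @large_clique V G k (conb G a).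
  by move=> s; apply: ff.
have [|U2 U21 c2] := @subset_of_card _ U1 (n - 2 * k).
  by have := card_nb_conbT G a; lia.
exists U2; split.
- exact: subset_trans U21 U1a.
- exact: cliqueS U21 cl1.
- by rewrite c2; have := n18; lia.
- rewrite disjoints_subset; apply/subsetP => x /(subsetP U21)/(subsetP U1a).
  rewrite in_conb in_setC => /andP[ax nax]; apply: contra nax => xU.
  exact: clU.
Qed.

Lemma deg_ge' x : n <= #|nb G x| + k + 1.
Proof. by have := deg_ge x; lia. Qed.

(** Without [n - #|U|] of its leaves, [H] fits into [U], and the vertices where these leaves hang
    can be placed on [low]. Having degree at least [n - 1], their images leave room for the
    leaves. *)
Lemma many_leaves_low : 2 * k < #|leaves H| -> n <= #|U| + #|low| ->
  subgraph_of H G.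
Proof.
move=> hL hlow; have /card_gt0P[v0 _] := V_gt0.
have [Q QL cQ] := @subset_of_card _ (leaves H) (n - #|U|) ltac:(lia).
have [_ gQ] := remove_leaves uH QL.
pose W := [set y in ~: Q | nb H y :&: Q != set0].
have Ql x : x \in Q -> x \in leaves H by apply: (subsetP QL).
have cW : #|W| <= #|Q|.
  apply: leq_trans (_ : #|\bigcup_(q in Q) nb H q| <= _).
    apply/subset_leq_card/subsetP => y; rewrite inE => /andP[_ /set0Pn[q /setIP[yq qQ]]].
    by apply/bigcupP; exists q; rewrite // -nb_sym.
  apply: leq_trans (card_bigcup_le _ _) _; rewrite -sum1_card.
  by apply: leq_sum => q /Ql; rewrite inE => /eqP ->.
have cQC := cardsC Q.
have [||||||||||||||f [ef _ _ fW]] :=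
  @slot_embedding T V H G v0 U set0 (~: Q) set0 W low 0 0 clU.
- by rewrite -setI_eq0 set0I.
- by apply/subsetP => a; rewrite inE => /andP[].
- exact: sub0set.
- by move=> x; rewrite inE.
- by move=> x y; rewrite inE.
- by move=> x; rewrite inE.
- by move=> y; rewrite setI0 cards0.
- by apply/subsetP => a; rewrite inE => /andP[].
- by move=> x; rewrite inE.
- by lia.
- by rewrite !cards0.
- by rewrite cards0; lia.
- by move=> x; rewrite inE.
- by rewrite cards0; have := n18; lia.
have [|g [eg _ _]] := grow_embed (good := fun=> setT) gQ ef.
  move=> S g x y QS _ _ gf _ _ xS yS xy _.
  have xQ : x \in Q by apply/negPn; rewrite -in_setC; apply: contra xS; apply: (subsetP QS).
  have yQ : y \in ~: Q.
    rewrite in_setC; apply: contraL xy => /Ql yl.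
    exact: (leaf_indep uH T_gt1 (Ql _ xQ) yl).
  have yW : y \in W.
    rewrite inE yQ; apply/set0Pn; exists x.
    by rewrite in_setI xQ in_nb adj_sym xy.
  have := fW y yW; rewrite -(gf y yQ) inE => /andP[_ low].
  have [|v vy vS] := @unused_nb T V G S g y yS; last by exists v; rewrite // setIT.
  rewrite -ltnS; apply: leq_trans (_ : n <= _); last by rewrite addn1 in low.
  rewrite -cT -[#|T|]cardsT; apply: proper_card; apply/properP; split; first exact: subsetT.
  by exists x.
exact: embedsT eg.
Qed.

(** Place [p] on [a]. Peeling all but [p] yields [S0], which contains no leaf of [H] and so fits
    into [K] apart from [p]; [p] has at most two neighbours in it. The vertices outside [Lp] are
    then added by the minimum degree, and the at least [k] leaves [Lp] last, by the degree of
    [a]. *)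
Lemma star_like a (K : {set V}) p : n <= #|nb G a| + 1 -> clique G K ->
  1 < #|nb G a :&: K| -> k <= nleaves H p -> n <= #|leaves H| + #|K| ->
  subgraph_of H G.
Proof.
move=> da clK aK hp hL.
pose Lp := nb H p :&: leaves H.
have [uB gB] := @remove_leaves T H uH Lp (subsetIr _ _).
have pL : p \notin leaves H.
  by apply/negP => /(nleaves_leaf uH T_gt1) e; move: hp; rewrite e; lia.
have [|S0 [pS gS uS dS]] := @peel T H [set p] (~: Lp) uB.
  by rewrite sub1set in_setC in_setI negb_and pL orbT.
rewrite sub1set in pS.
have dp := deg_in_le2 uS pS dS.
have S0L : S0 \subset ~: leaves H.
  apply/subsetP => x xS; rewrite in_setC; apply/negP => xl.
  have xp : x != p by apply: contraTneq xl => ->.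
  have := dS x xS; rewrite in_set1 => /(_ xp).
  by have := deg_in_le H S0 x; move: xl; rewrite inE => /eqP ->; lia.
have cS0 : #|S0| <= #|K|.
  by have := subset_leq_card S0L; have := cardsC (leaves H); lia.
pose D1 := nb H p :&: S0.
have pD1 : p \notin D1 by rewrite in_setI nb_irr.
have [|||f1 [f10 f1inj f1F]] :=
  @distinct_representatives T V [set p] D1 (fun=> a) (fun=> nb G a :&: K).
- by rewrite disjoints1.
- by move=> x y; rewrite !inE => /eqP -> /eqP ->.
- move=> y _; rewrite imset_set1 (setDidPl _) ?(leq_trans dp) //.
  by rewrite disjoint_sym disjoints1 in_setI nb_irr.
pose D2 := S0 :\: (p |: D1).
have [|||f [ff1 finj fF]] :=
  @distinct_representatives T V ([set p] :|: D1) D2 f1 (fun=> K).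
- by rewrite disjoint_sym disjoints_subset subsetDr.
- exact: f1inj.
- move=> y _.
  have sub : p |: D1 \subset S0 by rewrite subUset sub1set pS subsetIr.
  have := cardsD S0 (p |: D1); rewrite (setIidPr sub) -/D2.
  have := subset_leq_card (subsetIr K (f1 @: (p |: D1))).
  have : #|f1 @: (p |: D1)| <= #|p |: D1| by apply: leq_imset_card.
  by rewrite cardsD; lia.
have S0E : [set p] :|: D1 :|: D2 = S0.
  rewrite /D2 -[RHS](setID S0 (p |: D1)) (setIidPr _) //.
  by rewrite subUset sub1set pS subsetIr.
rewrite S0E in finj.
have fp : f p = a by rewrite ff1 ?f10 // !inE eqxx.
have fD1 y : y \in D1 -> f y \in nb G a :&: K.
  by move=> yD; rewrite ff1 ?f1F // in_setU yD orbT.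
have fK y : y \in S0 -> y != p -> f y \in K.
  rewrite -{1}S0E !in_setU in_set1 => /orP[/orP[/eqP ->|/fD1/setIP[]//]|/fF //].
  by rewrite eqxx.
have e0 : embeds H G S0 f.
  split=> // x y xS yS xy.
  have key z : z \in S0 -> adj H p z -> adj G (f p) (f z).
    move=> zS pz; have : z \in D1 by rewrite in_setI zS in_nb pz.
    by move=> /fD1/setIP[+ _]; rewrite fp in_nb.
  have [e|xp] := eqVneq x p; first by move: xy; rewrite e; apply: key.
  have [e|yp] := eqVneq y p.
    by move: xy; rewrite adj_sym (adj_sym G) e; apply: key.
  apply: clK; rewrite ?fK //; apply: contraTneq (adj_neq xy) => /finj e.
  by rewrite e ?eqxx.
have [|g [eg gf _]] := grow_embed (good := fun=> setT) gS e0.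
  move=> S g x y _ SB _ _ _ xB xS yS _ _.
  have [|v vy vS] := @unused_nb T V G S g y yS; last by exists v; rewrite // setIT.
  have : #|S| < #|~: Lp|.
    by apply: proper_card; apply/properP; split=> //; exists x.
  have := cardsC Lp; rewrite -/(nleaves H p) in hp *.
  by have := deg_ge' (g y); rewrite cT; move: hp; rewrite /nleaves -/Lp; lia.
have [|g2 [eg2 _ _]] := grow_embed (good := fun=> setT) gB eg.
  move=> S g2 x y BS _ _ gg _ _ xS yS xy _.
  have xL : x \in Lp by apply/negPn; rewrite -in_setC; apply: contra xS; apply: (subsetP BS).
  have yp : y = p.
    by case/setIP: xL; rewrite in_nb adj_sym => px xl; apply: (leafP xl).
  have [|v vy vS] := @unused_nb T V G S g2 y yS; last by exists v; rewrite // setIT.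
  have -> : g2 y = a.
    rewrite yp gg ?gf ?fp // in_setC in_setI negb_and pL ?orbT //.
  have : #|S| < #|T|.
    rewrite -[#|T|]cardsT; apply: proper_card; apply/properP; split; first exact: subsetT.
    by exists x.
  by rewrite cT; lia.
exact: embedsT eg2.
Qed.

Lemma many_leaves_star p : 2 * k < #|leaves H| -> k <= nleaves H p ->
  subgraph_of H G.
Proof.
move=> hL hp.
have [a da] := large_degree ff cV k17 nk.
have [aU|aU] := ltnP 1 #|nb G a :&: U|.
  by apply: (star_like da clU aU hp); lia.
have in_clique (K : {set V}) b : clique G K -> b \in K -> #|nb G b :&: K| + 1 = #|K|.
  move=> clK bK; rewrite (cardsD1 b K) bK addnC; congr (_ + _).
  apply: eq_card => z; rewrite !inE; case: (eqVneq z b) => [->|zb].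
    by rewrite adj_irrefl.
  by case zK: (z \in K); rewrite ?andbF // clK // eq_sym.
have [b bU] : exists b, b \in U by apply/card_gt0P; lia.
have [db|db] := leqP n (#|nb G b| + 1).
  apply: (star_like db clU _ hp); last lia.
  by have := in_clique U b clU bU; lia.
have [|U2 [_ cl2 c2 dis]] := second_clique bU; first lia.
apply: (star_like da cl2 _ hp); last lia.
(* At most [4 * k] vertices lie outside both cliques and at most one neighbour of [a] in [U], so
   most neighbours of [a] lie in [U2]. *)
have := cardsID U (nb G a); have := cardsID U2 (nb G a :\: U).
have : #|nb G a :\: U :\: U2| <= #|~: (U2 :|: U)|.
  by apply/subset_leq_card/subsetP => z; rewrite !inE negb_or => /and3P[-> ->].
have : #|(nb G a :\: U) :&: U2| <= #|nb G a :&: U2|.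
  by apply/subset_leq_card/setSI/subsetDl.
have := cardsC (U2 :|: U); have := leq_of_leqif (leq_card_setU U2 U).
have := cardsU U2 U; have := disjoint_setI0 dis => ->; rewrite cards0.
by lia.
Qed.

Lemma low_few_outside a : a \in U -> a \notin low -> #|nb G a :\: U| + #|U| < n.
Proof.
move=> aU; rewrite inE aU /= -ltnNge => da.
have := cardsID U (nb G a).
have : #|U :\ a| <= #|nb G a :&: U|.
  apply/subset_leq_card/subsetP => z; rewrite !inE => /andP[za zU].
  by rewrite zU andbT clU // eq_sym.
by have := cardsD1 a U; rewrite aU; lia.
Qed.

Lemma many_leaves_balanced : 2 * k < #|leaves H| -> (forall x, nleaves H x < k) ->
  subgraph_of H G.
Proof.
move=> hL hM.
have [hlow|hlow] := leqP n (#|U| + #|low|); first exact: many_leaves_low.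
have [I [cI dI iI hI]] := @slots3 T H uH T_gt1 k k17 ltac:(by rewrite cT) hM.
have [a /setDP[aU alow]] : exists a, a \in U :\: low.
  apply/card_gt0P; have : low \subset U by apply/subsetP => a; rewrite inE => /andP[].
  by rewrite cardsD => /setIidPr ->; lia.
have [|U2 [_ cl2 c2 dis]] := second_clique aU.
  by move: alow; rewrite inE aU /=; lia.
pose A := [set x | #|conb G x :&: U| <= 3 * k].
have UA : U \subset A.
  apply/subsetP => u uU; rewrite inE (_ : _ :&: _ = set0) ?cards0 //.
  apply/setP => z; rewrite in_setI in_conb in_set0; apply/negP.
  by move=> /andP[/andP[uz nuz] zU]; rewrite clU in nuz.
(* Otherwise [x] would be the centre of a fan between [U] and [U2]: more than [k] of its
   non-neighbours in [U] are not in [low], and each of those has at most [2 * k] neighbours outside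
   [U]. *)
have other x : x \notin A -> #|conb G x :&: U2| <= 3 * k.
  rewrite inE -ltnNge => hx; rewrite leqNgt; apply/negP => hx2.
  pose D := (conb G x :&: U) :\: low.
  have : #|D| <= k; last first.
    rewrite /D cardsD; have := subset_leq_card (subsetIr (conb G x :&: U) low).
    by lia.
  apply: (@fanfree_bipartite V G k x D (conb G x :&: U2)) => //.
  - by apply: subset_trans (subsetDl _ _) (subsetIl _ _).
  - exact: subsetIl.
  - rewrite disjoint_sym; apply: disjointWl (subsetIr _ _) _.
    by apply: disjointWr dis; apply: subset_trans (subsetDl _ _) (subsetIr _ _).
  - move=> u /setDP[/setIP[_ uU] ulow]; have := low_few_outside uU ulow.
    have := card_nb_conb G (conb G x :&: U2) u.
    have -> : u \in conb G x :&: U2 = false.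
      by apply/negP => /setIP[_] /(disjointFr dis); rewrite uU.
    have : #|nb G u :&: (conb G x :&: U2)| <= #|nb G u :\: U|.
      apply/subset_leq_card/subsetP => z /setIP[uz /setIP[_ z2]].
      by rewrite in_setD uz (disjointFr dis z2).
    by lia.
have [An|An] := leqP n #|A|.
  apply: (@slot_finish U (A :\: U) I 3 (3 * k)) => //; try lia.
  - by rewrite disjoints_subset subsetDr.
  - by rewrite cardsD (setIidPr UA); have := subset_leq_card UA; lia.
  - by move=> z; rewrite in_setD inE => /andP[].
apply: (@slot_finish U2 (~: A :\: U2) I 3 (3 * k)) => //; try lia.
- by rewrite disjoints_subset subsetDr.
- have := cardsID U2 (~: A); have := cardsC A.
  by have := subset_leq_card (subsetIr (~: A) U2); lia.
- by move=> z; rewrite in_setD in_setC => /andP[_]; apply: other.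
Qed.

(** * Targets with at most 2k leaves *)

Section FewLeaves.

Let R := n - #|U|.
Let cR : #|U| + R = n. Proof. by rewrite /R; lia. Qed.

Let R_gt2 : 2 < R. Proof. by rewrite /R; lia. Qed.
Let R_le : R + 2 <= #|U|. Proof. by rewrite /R; lia. Qed.

(** For [R] slots and [c = 1], [slot_embedding] allows exactly [#|U| - 2 * R] non-neighbours in [U];
    this fixes the threshold. *)
Let rich : {set V} := [set z in ~: U | 2 * R <= #|nb G z :&: U|].
Let poor : {set V} := ~: (U :|: rich).

Lemma rich_conb z : z \in rich -> #|conb G z :&: U| <= #|U| - 2 * R.
Proof.
rewrite inE => /andP[zU hz]; have := card_nb_conb G U z.
by move: zU; rewrite in_setC => /negbTE ->; lia.
Qed.

Lemma richU : [disjoint rich & U].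
Proof. by rewrite disjoints_subset; apply/subsetP => z; rewrite inE => /andP[]. Qed.

Lemma many_rich (I : {set T}) : spread H I -> 2 * k < #|I| -> R <= #|rich| ->
  subgraph_of H G.
Proof.
move=> sI cI hr; apply: (@slot_finish U rich I 1 (#|U| - 2 * R)) => //.
- exact: richU.
- by lia.
- by lia.
- by move: cR cI; lia.
- by case: sI.
- exact: spread_indep.
- by move=> y; apply: spread_one.
- exact: rich_conb.
- by lia.
Qed.

Section FewRich.
Hypothesis few_rich : #|rich| < R.

Lemma card_poor : n <= #|poor|.
Proof.
have := cardsC (U :|: rich); rewrite -/poor.
by have := leq_of_leqif (leq_card_setU U rich); lia.
Qed.

Lemma card_poor_le : #|poor| + #|U| < 2 * n.
Proof.
have := cardsC (U :|: rich); rewrite -/poor.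
by have := subset_leq_card (subsetUl U rich); lia.
Qed.

Lemma nb_split x (A : {set V}) : 
  #|nb G x :&: A| <=
    #|nb G x :&: A :&: U| + #|nb G x :&: A :&: rich| + #|nb G x :&: A :&: poor|.
Proof.
have := cardsID (U :|: rich) (nb G x :&: A).
rewrite setDE -/poor setIUr.
have := leq_of_leqif (leq_card_setU (nb G x :&: A :&: U) (nb G x :&: A :&: rich)).
lia.
Qed.

Lemma nbT_split x : #|nb G x| <= #|nb G x :&: U| + #|rich| + #|nb G x :&: poor|.
Proof.
have := nb_split x setT; rewrite setIT.
by have := subset_leq_card (subsetIr (nb G x) rich); lia.
Qed.

Lemma poor_deg z : z \in poor -> 2 * n <= #|nb G z :&: poor| + d + 3 * R.
Proof.
rewrite in_setC in_setU negb_or => /andP[zU zr].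
have hz : #|nb G z :&: U| < 2 * R.
  by rewrite ltnNge; apply: contra zr => h; rewrite inE in_setC zU.
by have := nbT_split z; have := deg_ge z; lia.
Qed.

Lemma poor_deg_R z : z \in poor -> 2 * R <= #|nb G z :&: poor|.
Proof. by move=> /poor_deg; lia. Qed.

(** Having few neighbours in [U] and in [rich], a poor vertex is adjacent to all but O(k) of the
    poor vertices. *)
Lemma poor_common x y : x \in poor -> y \in poor ->
  R < #|nb G x :&: nb G y :&: poor|.
Proof.
move=> /poor_deg hx /poor_deg hy.
have := cardsUI (nb G x :&: poor) (nb G y :&: poor).
rewrite setIACA setIid -setIUl.
have := subset_leq_card (subsetIr (nb G x :|: nb G y) poor).
by have := card_poor_le; lia.
Qed.

Lemma low_poor a : a \in low -> R <= #|nb G a :&: poor| + #|rich|.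
Proof.
rewrite inE => /andP[aU da]; have := nbT_split a.
have : #|nb G a :&: U| < #|U|.
  apply: proper_card; apply/properP; split; first exact: subsetIr.
  by exists a; rewrite // in_setI nb_irr.
by lia.
Qed.

(* The pendant vertices removed by [peel_slots] hang on vertices sent to [low],
   and are placed among the poor vertices; the rest goes to [U :|: rich]. *)
Lemma tree_like (I C : {set T}) :
  spread H I -> 2 * k < #|I| -> grows H C setT -> #|C| + R <= n ->
  R <= #|low| -> subgraph_of H G.
Proof.
move=> sI cI gC hC hlow; have /card_gt0P[v0 _] : 0 < #|V| by lia.
(* The number of vertices of [H] for which [U :|: rich] has no room. *)
pose j := R - #|rich|.
have [|||S [I1 [gS cS I1I cI1 prot]]] := @peel_slots T H C setT I j gC.
- by rewrite cardsT cT /j; lia.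
- by move=> *; rewrite inE subsetT.
- by case: sI.
rewrite cardsT cT in cS.
have [I2 I21 cI2] := @subset_of_card _ I1 #|rich| ltac:(rewrite /j in cI1; lia).
have I2I x : x \in I2 -> x \in I by move=> /(subsetP I21)/(subsetP I1I).
pose W := [set y in S | nb H y :&: ~: S != set0].
have cSC := cardsC S.
have cW : #|W| <= j.
  apply: leq_trans (_ : #|\bigcup_(q in ~: S) (nb H q :&: S)| <= _).
    apply/subset_leq_card/subsetP => y; rewrite inE => /andP[yS /set0Pn[q /setIP[yq qS]]].
    by apply/bigcupP; exists q; rewrite // in_setI yS -nb_sym yq.
  apply: leq_trans (card_bigcup_le _ _) _.
  apply: leq_trans (_ : \sum_(q in ~: S) 1 <= _); last by rewrite sum1_card; lia.
  by apply: leq_sum => q; rewrite in_setC; apply: (grows_nb gS); rewrite inE.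
have [||||||||||||||f [ef fI fU fW]] :=
  @slot_embedding T V H G v0 U rich S I2 W (low) 1 (#|U| - 2 * R) clU.
- exact: richU.
- by apply/subsetP => a; rewrite inE => /andP[].
- by apply/subsetP => x /(subsetP I21) xI; have [] := prot x xI x (setU11 _ _).
- by move=> x /(subsetP I21) xI; have [] := prot x xI x (setU11 _ _).
- by move=> x y /I2I xI /I2I; apply: (spread_indep sI).
- by move=> x /I2I; case: sI => d2 _; apply: d2.
- move=> y; apply: leq_trans (spread_one y sI); apply/subset_leq_card/setIS.
  by apply/subsetP => x /I2I.
- by apply/subsetP => a; rewrite inE => /andP[].
- move=> x /(subsetP I21) xI; rewrite disjoints_subset; apply/subsetP => z zx.
  have [_ nz] := prot x xI z zx; rewrite in_setC inE negb_and negbK; apply/orP; right.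
  by rewrite setI_eq0 disjoints_subset setCK.
- by rewrite /j in cW; lia.
- exact: cI2.
- by rewrite /j in cS; lia.
- exact: rich_conb.
- by rewrite cI2 /j in cW *; lia.
have fS x : x \in S -> f x \in U :|: rich.
  move=> xS; rewrite in_setU; have [/fI ->|xI] := boolP (x \in I2); first by rewrite orbT.
  by rewrite fU // in_setD xI.
have [|g [eg _ _]] := grow_embed (good := fun=> poor) gS ef.
  move=> S' g x y SS' _ _ gf gg _ xS' yS' xy _.
  have xS : x \notin S by apply: contra xS'; apply: (subsetP SS').
  have hdeg : j <= #|nb G (g y) :&: poor|.
    have [yS|yS] := boolP (y \in S).
      have yW : y \in W.
        rewrite inE yS; apply/set0Pn; exists x.
        by rewrite in_setI in_setC xS in_nb adj_sym xy.
      by rewrite gf // /j leq_subLR addnC low_poor ?fW.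
    have gyP : g y \in poor by apply: gg; rewrite in_setD yS.
    apply: leq_trans (poor_deg_R gyP); apply: leq_trans (leq_subr _ _) _.
    exact: leq_pmull.
  have [|v vy vN] := @pick_outside _ (nb G (g y) :&: poor) (g @: (S' :\: S)).
    apply: leq_ltn_trans (leq_imset_card _ _) _.
    apply: leq_trans hdeg; apply: leq_trans (_ : #|~: S| <= _); last by lia.
    apply: proper_card; apply/properP; split.
      by apply/subsetP => z; rewrite in_setD in_setC => /andP[].
    by exists x; rewrite ?in_setC // in_setD (negbTE xS') andbF.
  exists v => //; apply: contra vN => /imsetP[z zS' e]; rewrite e.
  apply: imset_f; rewrite in_setD zS' andbT; apply/negP => zS.
  move: vy; rewrite in_setI => /andP[_]; rewrite e gf // in_setC.
  by rewrite fS.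
exact: embedsT eg.
Qed.

Lemma cycle_like x0 (C : {set T}) (s : seq T) : grows H C setT -> n < #|C| + R ->
  uniq s -> s =i C ->
  (forall i j, i < size s -> j < size s -> adj H (nth x0 s i) (nth x0 s j) ->
      j = i.+1 %% size s \/ i = j.+1 %% size s) ->
  2 * R <= #|low| -> subgraph_of H G.
Proof.
move=> gC hC us sC hs hlow.
have lowU a : a \in low -> a \in U by rewrite inE => /andP[].
have poorU z : z \in poor -> z \notin U.
  by rewrite in_setC in_setU negb_or => /andP[].
have [a1 [b1 [a2 [b2 [a1U a2U a12 [b1P b2P b12 ab1 ab2]]]]]] :
    exists a1 b1 a2 b2, [/\ a1 \in U, a2 \in U, a1 != a2 &
      [/\ b1 \in poor, b2 \in poor, b1 != b2, adj G a1 b1 & adj G a2 b2]].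
  have low_nb a : a \in low -> exists2 b, b \in poor & adj G a b.
    move=> /low_poor ha; have /card_gt0P[b /setIP[ab bP]] : 0 < #|nb G a :&: poor| by lia.
    by exists b; rewrite // -in_nb.
  have /card_gt0P[a1 a1l] : 0 < #|low| by lia.
  have [b1 b1P ab1] := low_nb a1 a1l.
  (* A poor vertex is adjacent to fewer than [2 * R] vertices of [U], so some [a2] in [low] is not
     adjacent to [b1]; hence [a2] differs from [a1], and its poor neighbour from [b1]. *)
  have : ~~ (low \subset nb G b1).
    apply/negP => sub; move: b1P; rewrite in_setC in_setU negb_or => /andP[b1U].
    rewrite inE in_setC b1U -ltnNge ltnNge => /negP; apply.
    apply: leq_trans hlow _; apply/subset_leq_card/subsetP => a al.
    by rewrite in_setI (subsetP sub) ?lowU.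
  case/subsetPn=> a2 a2l; rewrite in_nb adj_sym => na2.
  have [b2 b2P ab2] := low_nb a2 a2l.
  exists a1, b1, a2, b2; split; [exact: lowU|exact: lowU| |split=> //].
    by apply: contraNneq na2 => <-.
  by apply: contraNneq na2 => ->.
apply: (@embed_across V G T H U poor a1 b1 a2 b2 R x0 C s) => //.
- by rewrite disjoints_subset; apply/subsetP => z /poorU; rewrite in_setC.
- by move=> u v; apply: poor_common.
- by move=> u; apply: poor_deg_R.
- by rewrite cT.
- by rewrite cT.
Qed.

(** Some vertex of [U] is not in [low] and provides [U2]. Only O(k) vertices lie outside both
    cliques, so every poor vertex has many neighbours in [U2], and [H] is embedded into
    [U2 :|: poor]. *)
Lemma few_low (I : {set T}) : spread H I -> 2 * k < #|I| -> #|low| < 2 * R -> subgraph_of H G.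
Proof.
move=> sI cI hlow.
have [a /setDP[aU alow]] : exists a, a \in U :\: low.
  apply/card_gt0P; have : low \subset U by apply/subsetP => a; rewrite inE => /andP[].
  by rewrite cardsD => /setIidPr ->; lia.
have [|U2 [_ cl2 c2 dis]] := second_clique aU.
  by move: alow; rewrite inE aU /=; lia.
have cP2 : #|poor :\: U2| + #|U| + #|U2| < 2 * n.
  have : #|poor :\: U2| <= #|~: (U :|: U2)|.
    by apply/subset_leq_card/subsetP => z; rewrite !inE !negb_or => /and3P[-> -> _].
  have := cardsC (U :|: U2); have := cardsU U U2.
  by rewrite setIC (disjoint_setI0 dis) cards0; lia.
(* The largest admissible value: [2 * k] slots are used, and [(n - 6 * k) + 4 * k = #|U2|]. *)
apply: (@slot_finish U2 (poor :\: U2) I 1 (n - 6 * k)) => //; try lia.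
- by rewrite disjoints_subset subsetDr.
- have := cardsID U2 poor; have := subset_leq_card (subsetIr poor U2).
  by have := card_poor; lia.
- by case: sI.
- exact: spread_indep.
- by move=> y; apply: spread_one.
- move=> z /setDP[zP z2]; have := card_nb_conb G U2 z; rewrite (negbTE z2).
  have := poor_deg zP; have := cardsID U2 (nb G z :&: poor).
  have : #|nb G z :&: poor :&: U2| <= #|nb G z :&: U2|.
    by apply/subset_leq_card/setSI/subsetIl.
  have : #|(nb G z :&: poor) :\: U2| <= #|poor :\: U2|.
    by apply/subset_leq_card/setSD/subsetIr.
  by lia.
Qed.

End FewRich.

End FewLeaves.

End Core.

Lemma unicyclic_subgraph : subgraph_of H G.
Proof.
have T1 := T_gt1; have /card_gt0P[v0 _] := V_gt0.
case: (@arg_maxnP V v0 xpredT (fun v => #|conb G v|) isT) => v _ vmax.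
pose d := #|conb G v|.
have deg_ge x : 2 * n <= #|nb G x| + d + 2.
  have hx : #|conb G x| <= d := vmax x isT.
  by have := card_nb_conbT G x; lia.
have [d_small|d_ge] := ltnP (d + 1) n.
  by apply: large_min_degree => x; have := deg_ge x; lia.
have [d_large|d_lt] := leqP (n + k) d; first exact: large_codegree d_large.
have [U1 _ [cl1 c1]] := large_clique (@ff v).
have [U U1U cU'] := @subset_of_card _ U1 (d - 2 * k) ltac:(rewrite /d; lia).
have clU := cliqueS U1U cl1.
have cU : #|U| + 2 * k = d by rewrite cU'; lia.
have [hL|hL] := ltnP (2 * k) #|leaves H|.
  have [p hp|hM] := pickP (fun p => k <= nleaves H p).
    exact: (many_leaves_star d_ge d_lt deg_ge clU cU hL hp).
  apply: (many_leaves_balanced d_ge d_lt clU cU hL) => x.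
  by rewrite ltnNge hM.
have [|I [cI d2 disI]] := @spread_slots T H uH T1 k k17 _ hL; first by rewrite cT.
have sI : spread H I by [].
(* The local definitions [R] and [rich] appear here unfolded. *)
have [hr|hr] := leqP (n - #|U|) #|[set z in ~: U | 2 * (n - #|U|) <= #|nb G z :&: U|]|.
  exact: (many_rich d_ge d_lt clU cU sI cI hr).
have [hlow|hlow] := ltnP #|low U| (2 * (n - #|U|)).
  exact: (few_low d_ge d_lt deg_ge clU cU hr sI cI hlow).
have [C [_ gC uC dC]] := peel uH (sub0set _).
have [hC|hC] := leqP (#|C| + (n - #|U|)) n.
  apply: (tree_like d_ge d_lt deg_ge clU cU hr sI cI gC hC).
  by lia.
have /card_gt0P[x0 _] := ltnW T1.
have [x xC|s [us sC s3 hs]] := cyclic_order x0 uC; first by apply: dC; rewrite ?inE.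
exact: (cycle_like d_ge d_lt deg_ge clU cU hr gC hC us sC hs hlow).
Qed.

End Host.

(** * The Ramsey number *)

Lemma fan_or_fanfree (V : finType) (G : sgraph V) k :
  subgraph_of (fan k.+1) (compl G) \/ fanfree G k.
Proof.
have /fin_all_exists2[S mS maxS] (x : V) := max_comatching G (conb G x).
have [x hx|h] := pickP (fun x => k < size (S x)).
  by left; apply: fan_of_comatching (mS x) hx.
right=> x s /maxS hs; apply: leq_trans hs _.
by rewrite leqNgt h.
Qed.

Lemma card_ord_lt M q : #|[set i : 'I_M | i < q]| <= q.
Proof.
rewrite cardE -(size_map val) -[X in _ <= X](size_iota 0 q); apply: uniq_leq_size.
  by rewrite (map_inj_uniq val_inj) enum_uniq.
by move=> i /mapP[j]; rewrite mem_enum inE mem_iota => hj ->.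
Qed.

Definition two_cliques_adj M q : rel 'I_M := fun i j => (i != j) && ((i < q) == (j < q)).

Lemma two_cliques_sym M q : symmetric (@two_cliques_adj M q).
Proof. by move=> i j; rewrite /two_cliques_adj eq_sym [in X in _ && X]eq_sym. Qed.

Lemma two_cliques_irrefl M q : irreflexive (@two_cliques_adj M q).
Proof. by move=> i; rewrite /two_cliques_adj eqxx. Qed.

Definition two_cliques M q : sgraph 'I_M :=
  SGraph (@two_cliques_sym M q) (@two_cliques_irrefl M q).

(** In two disjoint cliques with at most [n - 1] vertices each, a connected [H] would lie on one
    side. The complement is bipartite and contains no triangle, hence no fan. *)
Lemma connected_fan_lower n (H : sgraph 'I_n) m M : connected_graph H -> 0 < m ->
  0 < n -> M < 2 * n - 1 -> ~ ramsey_prop H (fan m) M.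
Proof.
move=> conn m0 n0 Mn /(_ (two_cliques M n.-1)) [[f [inj hom]]|[f [inj hom]]].
  have side x y : (f x < n.-1) = (f y < n.-1).
    have /connectP[p] := conn x y.
    elim: p x => [|z p IH] x /=; first by move=> _ ->.
    move=> /andP[xz pz] yl; rewrite -(IH z pz yl).
    by have /andP[_ /eqP] := hom _ _ xz.
  have cf : #|f @: setT| = n by rewrite card_imset // cardsT card_ord.
  pose x0 := Ordinal n0; have [lo|hi] := ltnP (f x0) n.-1.
    have : f @: setT \subset [set i : 'I_M | i < n.-1].
      by apply/subsetP => _ /imsetP[x _ ->]; rewrite inE -(side x0).
    move/subset_leq_card; rewrite cf => /leq_trans/(_ (card_ord_lt M n.-1)).
    by clear -n0; lia.
  pose A := [set i : 'I_M | i < n.-1].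
  have h1 : n <= #|~: A|.
    rewrite -cf; apply/subset_leq_card/subsetP => _ /imsetP[x _ ->].
    by rewrite !inE -(side x0) -leqNgt.
  have nM : n.-1 <= M by have := ltn_ord (f x0); lia.
  have h2 : n.-1 <= #|A|.
    have winj : injective (widen_ord nM) by move=> a b [] /ord_inj.
    rewrite -[X in X <= _]card_ord -(card_imset _ winj).
    by apply/subset_leq_card/subsetP => _ /imsetP[i _ ->]; rewrite inE /=.
  have h3 : #|A| + #|~: A| = M by rewrite cardsC card_ord.
  by clear -h1 h2 h3 Mn; lia.
pose i := Ordinal m0.
have h x y : adj (fan m) x y -> (f x < n.-1) != (f y < n.-1).
  by move=> /hom /andP[xy]; rewrite /= /two_cliques_adj xy.
have h1 := h None (Some (i, false)) isT; have h2 := h None (Some (i, true)) isT.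
have h3 : (f (Some (i, false)) < n.-1) != (f (Some (i, true)) < n.-1).
  exact: h.
by move: h1 h2 h3; case: (_ < _); case: (_ < _); case: (_ < _).
Qed.

Theorem theorem5 (m n : nat) (G : sgraph 'I_n) :
  18 <= m -> m ^ 2 - m + 1 <= n -> unicyclic G ->
  is_ramsey_number G (fan m) (2 * n - 1).
Proof.
case: m => // k k17 hn uG.
have nk : k * k + k + 1 <= n by move: hn; rewrite -mulnn; nia.
have n0 : 0 < n by lia.
split; [by lia | split=> [K|M /andP[_ Mn]]]; last first.
  by apply: connected_fan_lower Mn => //; case: uG.
have [|ff] := fan_or_fanfree K k; [by right | left].
have uT : unicyclic_on G setT by apply: unicyclic_onT => //; rewrite card_ord.
apply: (unicyclic_subgraph uT (card_ord n) ff _ k17 nk).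
by rewrite card_ord; lia.
Qed.
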